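(* Let $\beta\geq-1/3$. For every integer $m\geq2$ and every integer $k$ with $1\leq k\leq m-1$, $$\xi_{k,m+1}^{(\beta)}>\xi_{k,m}^{(\beta)}\qquad\text{and}\qquad \left|Q_{m+1}^{(\beta)}\bigl(\xi_{k,m+1}^{(\beta)}\bigr)\right|>\left|Q_m^{(\beta)}\bigl(\xi_{k,m}^{(\beta)}\bigr)\right|.$$
   Context: $P_n^{(\alpha,\beta)}$ is the Jacobi polynomial of degree $n$ normalised by $P_n^{(\alpha,\beta)}(1)=(\alpha+1)_n/n!$. For $\beta>-1$ and integers $m\geq1$ put $$Q_m^{(\beta)}(x)=2^{-\beta-1}(1+x)^{\beta+1}P_{m-1}^{(0,\beta+1)}(x).$$ On $(-1,1)$ one has $(Q_m^{(\beta)})'(x)=\frac{m+\beta}{2^{\beta+1}}(1+x)^\beta P_{m-1}^{(1,\beta)}(x)$, which has exactly $m-1$ zeros in $(-1,1)$, all simple; they are enumerated from right to left as $$1>\xi_{1,m}^{(\beta)}>\xi_{2,m}^{(\beta)}>\cdots>\xi_{m-1,m}^{(\beta)}>-1.$$ *)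

(* Defs.v *)
From HB Require Import structures.
From mathcomp Require Import all_boot all_order all_algebra.
From mathcomp Require Import finmap.
From mathcomp Require Import all_classical all_reals all_analysis.

Set Implicit Arguments.
Unset Strict Implicit.
Unset Printing Implicit Defensive.

Import Order.TTheory GRing.Theory Num.Theory.
Import numFieldNormedType.Exports.

Local Open Scope classical_set_scope.
Local Open Scope ring_scope.

(* Rising factorial (a)_n. *)
Definition pochhammer (R : realType) (a : R) (n : nat) : R :=
  \prod_(i < n) (a + i%:R).

(* (alpha+1)_n / n! * 2F1(-n, n+alpha+beta+1; alpha+1; (1-x)/2), using
   (-n)_j / j! = (-1)^j 'C(n, j) and
   (alpha+1)_n / (alpha+1)_j = (alpha+1+j)_(n-j). *)
Definition jacobi (R : realType) (n : nat) (alpha beta : R) : {poly R} :=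
  (n`!%:R)^-1 *:
  \sum_(j < n.+1)
    ('C(n, j)%:R * pochhammer (n%:R + alpha + beta + 1) j *
       pochhammer (alpha + 1 + j%:R) (n - j)) *:
    (2^-1 *: ('X - 1)) ^+ j.

Lemma jacobi_at1 (R : realType) (n : nat) (alpha beta : R) :
  (jacobi n alpha beta).[1] = pochhammer (alpha + 1) n / n`!%:R.
Proof.
rewrite /jacobi hornerZ horner_sum big_ord_recl big1 => [|i _].
  rewrite bin0 [pochhammer _ (val ord0)]big_ord0 subn0 expr0 !hornerE /=.
  by rewrite !mulr1 mulrC.
by rewrite !hornerE /= exprS subrr mulr0 !mul0r mulr0.
Qed.

(* Only used for m >= 1 and -1 < x. *)
Definition Q (R : realType) (beta : R) (m : nat) (x : R) : R :=
  2 `^ (- beta - 1) * (1 + x) `^ (beta + 1) * (jacobi m.-1 0 (beta + 1)).[x].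

Definition crit (R : realType) (beta : R) (m : nat) : set R :=
  [set x : R | -1 < x < 1 /\ derive1 (Q beta m) x = 0].

(* The k-th largest element of crit beta m, counted from k = 1; fset_set
   returns the empty set on an infinite set, and out-of-range indices
   return 0, but crit beta m has exactly m - 1 elements for beta > -1 and
   m >= 1. *)
Definition xi (R : realType) (beta : R) (k m : nat) : R :=
  nth 0 (sort >=%O (fset_set (crit beta m))) k.-1.

(* Main.v *)
Require Import Defs.
From HB Require Import structures.
From mathcomp Require Import all_boot all_order all_algebra.
From mathcomp Require Import finmap ring lra zify.
From mathcomp Require Import all_classical all_reals all_analysis.

(* With x = cos theta and w^2 = m (m + beta), the function Q_m solves the damped
   oscillator Q'' + h(theta) Q' + w^2 Q = 0, Q = 1 and Q' = 0 at theta = 0, where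
   h = (1 + a t^2) / (2 t), t = tan (theta / 2), a = 2 beta + 1; only w depends
   on m.  Put V = - Q' / w, E = Q^2 + V^2, and let phi be the polar angle of
   (Q, V): then dphi/dtheta = w - h sin phi cos phi, dE/dtheta = - 2 h V^2, phi
   increases up to the last critical point, and the k-th critical point is
   where phi = k pi.  Compare w1 < w2 at equal angles phi.  The faster oscillator
   reaches each angle at a smaller theta, i.e. at a larger x; moreover it is
   then less damped, h2 / w2 < h1 / w1, because the derivative of 1 / h decreases
   as long as h does (this needs a >= 1/3) and because h increases afterwards.
   Hence it has lost less energy, and at a critical point E = Q^2. *)

Set Implicit Arguments.
Unset Strict Implicit.
Unset Printing Implicit Defensive.

Import Order.TTheory GRing.Theory Num.Theory.
Import numFieldNormedType.Exports.

Local Open Scope classical_set_scope.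
Local Open Scope ring_scope.

(** * Calculus on the real line *)

(** The damping blows up like 1/theta at theta = 0, exactly where both oscillators start, so initial
    comparisons cannot be read off the equations. Writing V = t U keeps the solutions and the
    angular velocity continuous there, and each comparison of positions or damping ratios becomes a
    barrier argument: a difference with no positive limit at the start, decreasing near it as long
    as it is nonnegative and decreasing at each of its zeros, is negative throughout. Angles are
    matched because the product sin phi cos phi is then common to both oscillators. It drops out of
    k1/k2 at a crossing of the damping ratios, and out of the derivative of log (E2/E1), whose sign
    is left to h1 w2 - h2 w1. The bound on a comes from the start: there d/dtheta (1/h) = 1 + (1 -
    3a) t^2 + ..., and 3a >= 1 means beta >= -1/3. The oscillator itself is a pair of contiguous
    relations between the Jacobi polynomials with parameters (0, beta+1) and (1, beta). The number
    of critical points comes from Rolle's theorem applied along a Rodrigues recursion. *)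

Section pointwise_derivatives.
Context {R : realType}.
Implicit Types (f g : R -> R) (x a b : R).

Lemma is_derive_add f g x a b : is_derive x 1 f a -> is_derive x 1 g b ->
  is_derive x 1 (fun y => f y + g y) (a + b).
Proof. by move=> fa gb; exact: is_deriveD. Qed.

Lemma is_derive_opp f x a : is_derive x 1 f a ->
  is_derive x 1 (fun y => - f y) (- a).
Proof. by move=> fa; exact: is_deriveN. Qed.

Lemma is_derive_mul f g x a b : is_derive x 1 f a -> is_derive x 1 g b ->
  is_derive x 1 (fun y => f y * g y) (a * g x + f x * b).
Proof.
move=> fa gb.
have fgd : is_derive x 1 (fun y => f y * g y) (f x *: b + g x *: a).
  exact: is_deriveM.
by apply: is_derive_eq fgd _; rewrite /GRing.scale /= addrC [g x * a]mulrC.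
Qed.

Lemma is_derive_exp f x a n : is_derive x 1 f a ->
  is_derive x 1 (fun y => f y ^+ n) (n%:R * f x ^+ n.-1 * a).
Proof.
case: n => [|n] fa.
  rewrite !mul0r; under eq_fun do rewrite expr0; exact: is_derive_cst.
by have := is_deriveX n.+1 fa; rewrite exprfctE.
Qed.

Lemma is_derive_inv f x a : f x != 0 -> is_derive x 1 f a ->
  is_derive x 1 (fun y => (f y)^-1) (- a / f x ^+ 2).
Proof.
move=> fx fa; have fVd : is_derive x 1 (fun y => (f y)^-1) (- f x ^- 2 *: a).
  exact: is_deriveV.
by apply: is_derive_eq fVd _; rewrite /GRing.scale /= !mulNr mulrC.
Qed.

Lemma is_derive_fcomp f g x a b : is_derive (g x) 1 f a -> is_derive x 1 g b ->
  is_derive x 1 (fun y => f (g y)) (a * b).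
Proof. by move=> fa gb; exact: is_derive1_comp. Qed.

Lemma is_derive_continuous f x a : is_derive x 1 f a -> {for x, continuous f}.
Proof. by case=> /derivable1_diffP fx _; exact: differentiable_continuous. Qed.

End pointwise_derivatives.

(** Recursion on the syntax of the function. Derivatives of unknown functions are taken from the
    context; only the nonvanishing of denominators is left to the caller. *)
Ltac derivative := lazymatch goal with
  | |- is_derive _ _ (fun _ => ?c) _ => notypeclasses refine (is_derive_cst _ _ _)
  | |- is_derive _ _ (fun y => y) _ => notypeclasses refine (is_derive_id _ _)
  | |- is_derive _ _ (fun y => @GRing.add _ _ _) _ =>
      notypeclasses refine (is_derive_add _ _); derivative
  | |- is_derive _ _ (fun y => @GRing.opp _ _) _ =>
      notypeclasses refine (is_derive_opp _); derivative
  | |- is_derive _ _ (fun y => @GRing.mul _ _ _) _ =>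
      notypeclasses refine (is_derive_mul _ _); derivative
  | |- is_derive _ _ (fun y => @GRing.exp _ _ _) _ =>
      notypeclasses refine (is_derive_exp _ _); derivative
  | |- is_derive _ _ (fun y => @GRing.inv _ _) _ =>
      notypeclasses refine (is_derive_inv _ _); [ | derivative]
  | |- is_derive _ _ (@GRing.add _ _) _ =>
      notypeclasses refine (is_derive_add _ _); derivative
  | |- is_derive _ _ (@GRing.opp _) _ =>
      notypeclasses refine (is_derive_opp _); derivative
  | |- is_derive _ _ (@GRing.mul _ _) _ =>
      notypeclasses refine (is_derive_mul _ _); derivative
  | |- is_derive _ _ _ _ => eassumption
  end.

Section monotonicity.
Context {R : realType}.
Implicit Types (f df : R -> R) (a b c d x y t T : R).

Lemma within_continuous f a b : (forall x, a <= x <= b -> {for x, continuous f}) ->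
  {within `[a, b], continuous f}.
Proof.
move=> cf; apply: continuous_in_subspaceT => x.
by rewrite inE /= in_itv /=; exact: cf.
Qed.

Lemma mean_value f df a b : a < b ->
  (forall x, a < x < b -> is_derive x 1 f (df x)) ->
  (forall x, a <= x <= b -> {for x, continuous f}) ->
  exists2 c, a < c < b & f b - f a = df c * (b - a).
Proof.
move=> ab fdf /within_continuous cf.
have dab x : x \in `]a, b[ -> is_derive x 1 f (df x).
  by rewrite in_itv /=; exact: fdf.
have [c cab E] := MVT ab dab cf.
by exists c => //; move: cab; rewrite in_itv.
Qed.

Lemma increasing_of_derive f df a b : a < b ->
  (forall x, a < x < b -> is_derive x 1 f (df x)) ->
  (forall x, a <= x <= b -> {for x, continuous f}) ->
  (forall x, a < x < b -> 0 < df x) -> f a < f b.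
Proof.
move=> ab fdf cf df0; have [c cab E] := mean_value ab fdf cf.
by rewrite -subr_gt0 E mulr_gt0 ?df0 ?subr_gt0.
Qed.

Lemma nondecreasing_of_derive f df a b : a <= b ->
  (forall x, a < x < b -> is_derive x 1 f (df x)) ->
  (forall x, a <= x <= b -> {for x, continuous f}) ->
  (forall x, a < x < b -> 0 <= df x) -> f a <= f b.
Proof.
rewrite le_eqVlt => /predU1P[->//|ab] fdf cf df0.
have [c cab E] := mean_value ab fdf cf.
by rewrite -subr_ge0 E mulr_ge0 ?df0 // subr_ge0 ltW.
Qed.

Lemma intermediate_value f a b y : a <= b ->
  (forall x, a <= x <= b -> {for x, continuous f}) ->
  f a <= y <= f b -> exists2 c, a <= c <= b & f c = y.
Proof.
move=> ab /within_continuous cf /andP[fay yfb].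
have [|c cab E] := IVT ab cf (v := y).
  by rewrite ge_min fay le_max yfb orbT.
by exists c => //; move: cab; rewrite in_itv.
Qed.

Lemma first_zero f a b : a < b ->
  (forall x, a <= x <= b -> {for x, continuous f}) -> f a < 0 -> 0 <= f b ->
  exists c, [/\ a < c <= b, f c = 0 & forall x, a <= x < c -> f x < 0].
Proof.
move=> ab cf fa0 fb0.
(* The zero is the infimum of the points where [f] is nonnegative: a negative value there would
   persist on a ball, and a positive one would already occur to its left. *)
pose S := [set x | a <= x <= b /\ 0 <= f x].
have Sb : S b by split => //; rewrite lexx ltW.
have lbS : lbound S a by move=> x [/andP[]].
have iS : has_inf S by split; [exists b | exists a].
pose c := inf S.
have ac : a <= c by apply: lb_le_inf => //; exists b.
have cb : c <= b by apply: ge_inf => //; exists a.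
have below x : a <= x < c -> f x < 0.
  move=> /andP[ax xc]; rewrite ltNge; apply/negP => fx0.
  have : c <= x.
    apply: ge_inf; first by exists a.
    by split => //; rewrite ax (le_trans (ltW xc)).
  by rewrite leNgt xc.
have cfc : {for c, continuous f} by apply: cf; rewrite ac cb.
have fc0 : 0 <= f c.
  rewrite leNgt; apply/negP => fc0.
  have /nbhs_ballP[e /= e0 He] : \forall x \near c, f x < 0.
    exact: (cvgr_lt (f c) cfc).
  have [x Sx xc] := inf_adherent e0 iS.
  have cx : c <= x by apply: ge_inf => //; exists a.
  have : f x < 0.
    by apply: He; rewrite /ball /= ltr_distlC; rewrite -/c in xc; lra.
  by case: Sx => _; rewrite leNgt => /negP.
have ltac : a < c.
  by rewrite lt_neqAle ac andbT; apply/eqP => E; move: fc0; rewrite -E leNgt fa0.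
exists c; split => //; first by rewrite ltac.
apply/eqP; rewrite eq_le fc0 andbT leNgt; apply/negP => fcp.
have /nbhs_ballP[e /= e0 He] : \forall x \near c, 0 < f x.
  exact: (cvgr_gt (f c) cfc).
pose x := Num.max a (c - e / 2).
have axc : a <= x < c by rewrite /x le_max lexx gt_max ltac; lra.
have : 0 < f x.
  apply: He; rewrite /ball /= ltr_distlC.
  have : c - e / 2 <= x by rewrite /x le_max lexx orbT.
  by move: axc => /andP[_ xc] cx; lra.
by move=> /ltW; rewrite leNgt (below _ axc).
Qed.

(** Difference quotients from the left are positive, whereas a negative derivative would make them
    negative close to [c]. *)
Lemma derive_ge0_of_last_zero f a c d : a < c ->
  is_derive c 1 f d -> (forall x, a <= x < c -> f x < f c) -> 0 <= d.
Proof.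
move=> ac fd fneg; rewrite leNgt; apply/negP => d0.
have [drv dE] := fd.
have : ((fun h : R => h^-1 *: ((f \o shift c) (h *: 1) - f c)) h) @[h --> 0^'] --> d.
  by rewrite -dE; apply: drv.
move=> /(cvgr_lt d) /(_ 0 d0) /nbhs_ballP[e /= e0 He].
pose h := - Num.min (e / 2) (c - a).
have h0 : h < 0 by rewrite /h oppr_lt0 lt_min; apply/andP; split; lra.
have he : - e < h.
  rewrite /h ltrN2; apply: (@le_lt_trans _ _ (e / 2)); last lra.
  by rewrite ge_min lexx.
have hc : a <= c + h.
  suff : Num.min (e / 2) (c - a) <= c - a by rewrite /h; lra.
  by rewrite ge_min lexx orbT.
have hball : ball 0 e h by rewrite /ball /= sub0r normrN ltr0_norm //; lra.
have hn0 : h != 0 by rewrite lt_eqF.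
have := He h hball hn0.
rewrite /= /GRing.scale /= mulr1 [h + c]addrC.
apply/negP; rewrite -leNgt mulr_le0 //.
  by rewrite invr_le0 ltW.
by rewrite subr_le0 ltW // fneg //; lra.
Qed.

(* Near the start [f] decreases wherever [f >= 0], so it cannot leave [0]
   upwards; later on it cannot cross [0] upwards either. *)
Lemma negative_of_barrier f df T d : 0 < d ->
  (forall t, 0 < t < T -> is_derive t 1 f (df t)) ->
  (forall e, 0 < e -> exists2 r, 0 < r & forall t, 0 < t < T -> t < r -> f t < e) ->
  (forall t, 0 < t < T -> f t = 0 -> df t < 0) ->
  (forall t, 0 < t < T -> t < d -> 0 <= f t -> df t < 0) ->
  forall t, 0 < t < T -> f t < 0.
Proof.
move=> d0 fdf f0 fcross fstart.
have cf t : 0 < t < T -> {for t, continuous f}.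
  by move=> /fdf; exact: is_derive_continuous.
have nocross a b : 0 < a -> a < b -> b < T -> f a < 0 -> 0 <= f b -> False.
  move=> a0 ab bT fa fb.
  have [|c [/andP[ac cb] fc neg]] := first_zero ab _ fa fb.
    by move=> x /andP[ax xb]; apply: cf; lra.
  have cT : 0 < c < T by lra.
  have : 0 <= df c.
    by apply: (derive_ge0_of_last_zero ac (fdf _ cT)) => x; rewrite fc; exact: neg.
  by rewrite leNgt fcross.
move=> t tT; rewrite ltNge; apply/negP => ft.
have pos x : 0 < x <= t -> 0 <= f x.
  rewrite le_eqVlt => /andP[x0 /predU1P[->//|xt]].
  rewrite leNgt; apply/negP => fx; apply: (nocross x t) => //.
  by case/andP: tT.
(* On [(0, u]] the function is nonnegative, hence strictly decreasing; so near [0] it exceeds the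
   positive number [f (u / 2)], against the smallness assumed there. *)
pose u := Num.min t (d / 2).
have ut : u <= t by rewrite /u ge_min lexx.
have ud : u < d by rewrite /u gt_min; apply/orP; right; lra.
have u0 : 0 < u by rewrite /u lt_min; apply/andP; split; lra.
have dec x y : 0 < x -> x < y -> y <= u -> f y < f x.
  move=> x0 xy yu; rewrite -ltrN2.
  apply: (@increasing_of_derive (fun z => - f z) (fun z => - df z)) => //.
  - by move=> z zxy; apply: is_derive_opp; apply: fdf; lra.
  - by move=> z zxy; apply: continuousN; apply: cf; lra.
  - by move=> z zxy; rewrite oppr_gt0 fstart //; [lra..| apply: pos; lra].
have fu2 : 0 < f (u / 2).
  by apply: (le_lt_trans (pos u _)); [lra | apply: dec; lra].
have [r r0 Hr] := f0 _ fu2.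
pose v := Num.min (u / 4) (r / 2).
have v0 : 0 < v by rewrite /v lt_min; apply/andP; split; lra.
have vu : v <= u / 4 by rewrite /v ge_min lexx.
have vr : v <= r / 2 by rewrite /v ge_min lexx orbT.
have : f v < f (u / 2) by apply: Hr; lra.
by apply/negP; rewrite -leNgt ltW // dec //; lra.
Qed.

End monotonicity.

(** * Polar angles *)

Section phase.
Context {R : realType}.
Implicit Types (t u T : R).

(** [s] is the inverse of [phi2] composed with [phi1]: the place where the second motion reaches the
    angle that the first has at [t]. The assumption on the final angles guarantees that it gets
    there. Since [s] is controlled only on the open interval, its limit at [0] is a separate
    clause. *)
Lemma phase_matching (phi1 phi2 d1 d2 : R -> R) T1 T2 :
  0 < T1 -> 0 < T2 ->
  (forall t, 0 <= t <= T1 -> is_derive t 1 phi1 (d1 t)) ->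
  (forall t, 0 <= t <= T2 -> is_derive t 1 phi2 (d2 t)) ->
  (forall t, 0 <= t <= T1 -> 0 < d1 t) ->
  (forall t, 0 <= t <= T2 -> 0 < d2 t) ->
  phi1 0 = 0 -> phi2 0 = 0 -> phi1 T1 <= phi2 T2 ->
  exists s : R -> R,
  [/\ forall t, 0 < t < T1 -> [/\ 0 < s t < T2, phi2 (s t) = phi1 t &
        is_derive t 1 s (d1 t / d2 (s t))],
      forall t u, 0 < t < T1 -> 0 < u < T2 -> phi1 t = phi2 u -> s t = u &
      forall e, 0 < e -> exists2 r, 0 < r &
        forall t, 0 < t < T1 -> t < r -> s t < e].
Proof.
move=> T10 T20 D1 D2 d1pos d2pos phi10 phi20 phiT.
have c1 t : 0 <= t <= T1 -> {for t, continuous phi1}.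
  by move=> /D1; exact: is_derive_continuous.
have c2 t : 0 <= t <= T2 -> {for t, continuous phi2}.
  by move=> /D2; exact: is_derive_continuous.
have inc1 t u : 0 <= t -> t < u -> u <= T1 -> phi1 t < phi1 u.
  move=> t0 tu uT; apply: (increasing_of_derive tu (df := d1)) => x xtu.
  - by apply: D1; lra.
  - by apply: c1; lra.
  - by apply: d1pos; lra.
have inc2 t u : 0 <= t -> t < u -> u <= T2 -> phi2 t < phi2 u.
  move=> t0 tu uT; apply: (increasing_of_derive tu (df := d2)) => x xtu.
  - by apply: D2; lra.
  - by apply: c2; lra.
  - by apply: d2pos; lra.
have inj2 t u : 0 <= t <= T2 -> 0 <= u <= T2 -> phi2 t = phi2 u -> t = u.
  move=> t2 u2 E; apply/eqP; rewrite eq_le !leNgt; apply/andP; split;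
  by apply/negP => tu; have := inc2 _ _ _ tu; rewrite E ltxx => h;
    suff : false by []; apply: h; lra.
(* The preimage of [y] in [(0, T2)], with default [0] if there is none. *)
pose g y := xget 0 [set u | 0 < u < T2 /\ phi2 u = y].
have g2 u : 0 < u < T2 -> g (phi2 u) = u.
  move=> u2; have : [set v | 0 < v < T2 /\ phi2 v = phi2 u] (g (phi2 u)).
    by apply: (@xgetPex _ 0 [set v | 0 < v < T2 /\ phi2 v = phi2 u]); exists u.
  by case=> g2 E; apply: inj2 => //; lra.
pose s t := g (phi1 t).
have sP t : 0 < t < T1 -> 0 < s t < T2 /\ phi2 (s t) = phi1 t.
  move=> t1; suff : exists u, 0 < u < T2 /\ phi2 u = phi1 t.
    by move=> [u [u2 E]]; rewrite /s -E g2.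
  have p0 : 0 < phi1 t by rewrite -phi10; apply: inc1; lra.
  have pT : phi1 t < phi2 T2 by apply: lt_le_trans phiT; apply: inc1; lra.
  have [||u u2 E] := @intermediate_value _ phi2 0 T2 (phi1 t) (ltW T20).
  - by move=> x; exact: c2.
  - by rewrite phi20; lra.
  exists u; split => //; rewrite !lt_neqAle; move: u2 => /andP[-> ->].
  rewrite !andbT; apply/andP; split; apply/eqP => uE; move: E.
  - by rewrite -uE phi20 => E; move: p0; rewrite -E ltxx.
  - by rewrite uE => E; move: pT; rewrite -E ltxx.
exists s; split.
- move=> t t1; have [s2 E] := sP t t1; split => //.
  have nearT : \forall x \near s t, 0 < x < T2.
    have : s t \in `]0, T2[ by rewrite in_itv.
    move=> /near_in_itvoo; apply: filterS => x; by rewrite in_itv.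
  have Dg : is_derive (phi2 (s t)) 1 g (d2 (s t))^-1.
    apply: is_derive_inverse.
    + by apply: filterS nearT; exact: g2.
    + by apply: filterS nearT => x x2; apply: c2; lra.
    + by apply: D2; lra.
    + by rewrite gt_eqF // d2pos //; lra.
  rewrite E in Dg; rewrite mulrC; apply: (is_derive_fcomp Dg).
  by apply: D1; lra.
- by move=> t u t1 u2 E; rewrite /s E g2.
- move=> e e0; pose e' := Num.min e T2.
  have e'0 : 0 < e' by rewrite /e' lt_min e0.
  have e'e : e' <= e by rewrite /e' ge_min lexx.
  have e'T : e' <= T2 by rewrite /e' ge_min lexx orbT.
  have pe : phi1 0 < phi2 e' by rewrite phi10 -phi20; apply: inc2; lra.
  have c10 : {for 0, continuous phi1} by apply: c1; rewrite lexx ltW.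
  have /nbhs_ballP[r /= r0 Hr] : \forall x \near 0, phi1 x < phi2 e'.
    exact: (cvgr_lt (phi1 0) c10).
  exists r => // t t1 tr; have [s2 E] := sP t t1.
  rewrite (lt_le_trans _ e'e) // ltNge; apply/negP => es.
  have : phi1 t < phi2 e'.
    by apply: Hr; rewrite /ball /= sub0r normrN gtr0_norm //; lra.
  rewrite -E ltNge le_eqVlt => /negP; apply; move: es.
  rewrite le_eqVlt => /predU1P[->|es]; first by rewrite eqxx.
  by rewrite inc2 ?orbT //; lra.
Qed.

Lemma antiderivative (f : R -> R) T : 0 < T -> continuous f ->
  exists F : R -> R, F 0 = 0 /\ forall t, 0 <= t <= T -> is_derive t 1 F (f t).
Proof.
move=> T0 cf.
(* Integrating from [-1] makes [0] an interior point, so that the derivative there is two-sided. *)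
pose F x := (\int[lebesgue_measure]_(y in `[- 1, x]) f y)%R.
exists (fun x => F x - F 0); split; first by rewrite subrr.
move=> t tT.
have intf : lebesgue_measure.-integrable `[- 1, T + 1] (EFin \o f).
  apply: continuous_compact_integrable; first exact: segment_compact.
  exact: continuous_subspaceT.
have tT1 : t < T + 1 by lra.
have t1 : - 1 < t by lra.
have [dF EF] := continuous_FTC1_closed tT1 intf t1 (cf t).
have DF : is_derive t 1 F (f t).
  by apply: DeriveDef; [exact: dF | rewrite -derive1E EF].
rewrite -[f t]addr0 -oppr0; exact: (is_derive_add DF).
Qed.

(** Integrating the prescribed velocity [f] avoids choosing branches of an arctangent. The quotient
    of [B ^+ 2] by the squared radius is the squared sine of the difference between the true angle
    and [phi]; it has derivative zero and vanishes at [0]. As [B = 0] fixes the direction only up to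
    sign, the conclusions are products that do not change when [phi] is shifted by [pi]. *)
Lemma polar_angle (Q V dQ dV f : R -> R) T : 0 < T ->
  (forall t, 0 < t <= T -> is_derive t 1 Q (dQ t)) ->
  (forall t, 0 < t <= T -> is_derive t 1 V (dV t)) ->
  (forall t, 0 <= t <= T -> {for t, continuous Q}) ->
  (forall t, 0 <= t <= T -> {for t, continuous V}) ->
  (forall t, 0 <= t <= T -> 0 < Q t ^+ 2 + V t ^+ 2) ->
  V 0 = 0 -> continuous f ->
  (forall t, 0 < t <= T ->
     f t * (Q t ^+ 2 + V t ^+ 2) = dV t * Q t - dQ t * V t) ->
  exists phi : R -> R,
  [/\ phi 0 = 0, forall t, 0 <= t <= T -> is_derive t 1 phi (f t),
     forall t, 0 <= t <= T ->
       Q t * V t = (Q t ^+ 2 + V t ^+ 2) * (sin (phi t) * cos (phi t)) &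
     forall t, 0 <= t <= T ->
       V t ^+ 2 = (Q t ^+ 2 + V t ^+ 2) * sin (phi t) ^+ 2].
Proof.
move=> T0 DQ DV cQ cV Epos V0 cf fE.
have [phi [phi0 Dphi]] := antiderivative T0 cf.
pose B t := V t * cos (phi t) - Q t * sin (phi t).
have Dsin t : 0 <= t <= T ->
    is_derive t 1 (fun x => sin (phi x)) (cos (phi t) * f t).
  by move=> /Dphi D; exact: is_derive_fcomp.
have Dcos t : 0 <= t <= T ->
    is_derive t 1 (fun x => cos (phi x)) (- sin (phi t) * f t).
  by move=> /Dphi D; exact: is_derive_fcomp.
(* With the minus sign, monotonicity gives [0 = G 0 <= G t], hence [B t ^+ 2 <= 0]. *)
pose G t := - (B t ^+ 2 / (Q t ^+ 2 + V t ^+ 2)).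
have DG t : 0 < t <= T -> is_derive t 1 G 0.
  move=> tT; have tT' : 0 <= t <= T by lra.
  have := DQ t tT; have := DV t tT; have := Dsin t tT'; have := Dcos t tT'.
  move=> Dc Ds DVt DQt.
  have E0 := Epos t tT'.
  rewrite /G /B.
  notypeclasses refine (is_derive_eq _ _).
    by derivative; rewrite gt_eqF.
  cbv beta.
  have Ene : Q t ^+ 2 + V t ^+ 2 != 0 by rewrite gt_eqF.
  have dVE : f t = (dV t * Q t - dQ t * V t) / (Q t ^+ 2 + V t ^+ 2).
    by rewrite -fE // mulfK.
  rewrite dVE /= !expr1.
  move: (Q t) (V t) (dQ t) (dV t) (cos (phi t)) (sin (phi t)) Ene => q v q' v' c s Ene.
  by field.
have cG t : 0 <= t <= T -> {for t, continuous G}.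
  move=> tT; apply: continuousN; apply: continuousM; last first.
    apply: continuousV; first by rewrite gt_eqF // Epos.
    by apply: continuousD; apply: continuousM; (apply: cQ || apply: cV).
  have cB : {for t, continuous B}.
    apply: continuousB; apply: continuousM; (try exact: cQ); (try exact: cV).
    - exact: is_derive_continuous (Dcos t tT).
    - exact: is_derive_continuous (Dsin t tT).
  by apply: continuousM.
have B0 t : 0 <= t <= T -> B t = 0.
  move=> tT; have : G 0 <= G t.
    apply: (@nondecreasing_of_derive _ _ (fun=> 0)); first by case/andP: tT.
    - by move=> x xt; apply: DG; lra.
    - by move=> x xt; apply: cG; lra.
    - by [].
  rewrite /G /B V0 phi0 sin0 mul0r mulr0 subrr expr0n /= mul0r oppr0 oppr_ge0.
  by rewrite pmulr_lle0 ?invr_gt0 ?Epos // => h;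
    apply/eqP; rewrite -sqrf_eq0 eq_le h sqr_ge0.
exists phi; split => // t tT; move: (B0 t tT); rewrite /B => /eqP;
  rewrite subr_eq0 => /eqP E; have := cos2Dsin2 (phi t); 
  move: (Q t) (V t) (cos (phi t)) (sin (phi t)) E => q v c s E cs.
- rewrite -[LHS]mulr1 -cs.
  have h : (v * c - q * s) * (q * c - v * s) = 0 by rewrite E subrr mul0r.
  by apply: subr0_eq; rewrite -[RHS]h; ring.
- rewrite -[LHS]mulr1 -cs.
  have h : (v * c - q * s) * (v * c + q * s) = 0 by rewrite E subrr mul0r.
  by apply: subr0_eq; rewrite -[RHS]h; ring.
Qed.

End phase.

(** * The damped oscillator *)

Section oscillator.
Context {R : realType}.
Implicit Types (a w t u x y c T : R) (Q U phi : R -> R).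

Definition damping a t := (1 + a * t ^+ 2) / (2 * t).

(* With [t = tan (theta / 2)] and [V t = t * U t] this is the system
   [dQ/dtheta = - w V], [dV/dtheta = w Q - damping V], regular at [t = 0]. *)
Definition oscillator a w Q U :=
  [/\ continuous Q /\ continuous U, Q 0 = 1, U 0 = w,
      forall t, 0 < t -> is_derive t 1 Q (- (2 * w * (t * U t) / (1 + t ^+ 2))) &
      forall t, 0 < t -> is_derive t 1 (fun x => x * U x)
        (2 * (w * Q t - damping a t * (t * U t)) / (1 + t ^+ 2))].

Definition energy Q U t := Q t ^+ 2 + (t * U t) ^+ 2.

(** The velocity in [t] of the polar angle of [(Q, t * U)], with dtheta/dt = 2 / (1 + t^2) as first
    factor. The [t] of [t * U] is cancelled against the denominator of the damping, so that the
    formula is also correct at [0]. *)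
Definition phase_rate a w Q U t :=
  2 / (1 + t ^+ 2) * (w - (1 + a * t ^+ 2) / 2 * (Q t * U t / energy Q U t)).

Lemma oneDsqr_gt0 t : 0 < 1 + t ^+ 2.
Proof. by have := sqr_ge0 t; lra. Qed.

Lemma is_derive_powR_oneDsqr c t : is_derive t 1 (fun x => (1 + x ^+ 2) `^ c)
  (2 * c * t / (1 + t ^+ 2) * (1 + t ^+ 2) `^ c).
Proof.
have r0 := oneDsqr_gt0 t.
have D : is_derive t 1 (fun x => 1 + x ^+ 2) (0 + 2%:R * t ^+ 1 * 1).
  by derivative.
notypeclasses refine (is_derive_eq (is_derive_fcomp (f := fun y => y `^ c)
  (g := fun x => 1 + x ^+ 2)
  (is_derive1_powR c r0) D) _).
rewrite powRB; last by rewrite (gt_eqF r0) implybT.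
rewrite powRr1 ?ltW // expr1 add0r.
by field; rewrite gt_eqF.
Qed.

(** A solution P of dP/dtheta = h P, where h is the damping. *)
Definition integrating_factor a t := t * (1 + t ^+ 2) `^ ((a - 1) / 2).

Lemma integrating_factor_gt0 a t : 0 < t -> 0 < integrating_factor a t.
Proof. by move=> t0; rewrite mulr_gt0 // powR_gt0 // oneDsqr_gt0. Qed.

Lemma is_derive_integrating_factor a t : 0 < t ->
  is_derive t 1 (integrating_factor a)
    ((1 + a * t ^+ 2) / (t * (1 + t ^+ 2)) * integrating_factor a t).
Proof.
move=> t0; have r0 := oneDsqr_gt0 t; rewrite /integrating_factor.
have := is_derive_powR_oneDsqr ((a - 1) / 2) t.
set k := (_ `^ _) => Dk.
notypeclasses refine (is_derive_eq (is_derive_mul (is_derive_id t 1) Dk) _).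
by rewrite -/k; field; rewrite !gt_eqF.
Qed.

Lemma continuous_integrating_factor a : continuous (integrating_factor a).
Proof.
move=> t; apply: is_derive_continuous.
exact: (is_derive_mul (is_derive_id t 1) (is_derive_powR_oneDsqr _ t)).
Qed.

Section one_oscillator.
Variables (a w : R) (Q U : R -> R).
Hypotheses (a0 : 0 < a) (w0 : 0 < w) (osc : oscillator a w Q U).
Let V t := t * U t.

Let cQ : continuous Q. Proof. by have [[]] := osc. Qed.
Let cU : continuous U. Proof. by have [[]] := osc. Qed.

Lemma continuous_energy t : {for t, continuous (energy Q U)}.
Proof.
have cV : {for t, continuous V}.
  by apply: continuousM; [exact: is_derive_continuous (is_derive_id _ _) | exact: cU].
rewrite /energy; apply: continuousD; apply: continuousM => //; exact: cQ.
Qed.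

Lemma energy0 : energy Q U 0 = 1.
Proof. by have [_ Q0 _ _ _] := osc; rewrite /energy Q0 mul0r expr1n expr0n addr0. Qed.

Lemma is_derive_energy t : 0 < t -> is_derive t 1 (energy Q U)
  (- (4 * damping a t * (t * U t) ^+ 2 / (1 + t ^+ 2))).
Proof.
move=> t0; have [_ _ _ /(_ t t0) DQ /(_ t t0) DV] := osc.
rewrite /energy.
notypeclasses refine (is_derive_eq
  (is_derive_add (is_derive_exp 2 DQ) (is_derive_exp 2 DV)) _).
rewrite /= !expr1; move: (damping a t) (t * U t) (Q t) => h v q.
by field; rewrite gt_eqF // oneDsqr_gt0.
Qed.

(** The energy decreases, so its value at [0] does not suffice. Multiplied by the square of the
    integrating factor P it has theta derivative 2 h P^2 Q^2, hence is nondecreasing, and it is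
    positive close to [0]. *)
Lemma energy_gt0 t : 0 <= t -> 0 < energy Q U t.
Proof.
rewrite le_eqVlt => /predU1P[<-|t0]; first by rewrite energy0.
have E_ge0 x : 0 <= energy Q U x by rewrite addr_ge0 ?sqr_ge0.
pose G x := energy Q U x * integrating_factor a x ^+ 2.
have cG x : {for x, continuous G}.
  apply: continuousM; first exact: continuous_energy.
  by apply: continuousM; exact: continuous_integrating_factor.
pose dG x := 2 * (1 + a * x ^+ 2) / (x * (1 + x ^+ 2)) *
  integrating_factor a x ^+ 2 * Q x ^+ 2.
have DG x : 0 < x -> is_derive x 1 G (dG x).
  move=> x0; have DE := is_derive_energy x0.
  have DP := is_derive_integrating_factor a x0.
  notypeclasses refine (is_derive_eq (is_derive_mul DE (is_derive_exp 2 DP)) _).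
  rewrite /dG /damping /energy /= !expr1.
  move: (integrating_factor a x) (Q x) (U x) => k q y.
  by field; rewrite !gt_eqF // oneDsqr_gt0.
have dG_ge0 x : 0 < x -> 0 <= dG x.
  move=> x0; have := sqr_ge0 x => x2.
  have ax2 := mulr_ge0 (ltW a0) x2.
  rewrite /dG mulr_ge0 ?sqr_ge0 // mulr_ge0 ?sqr_ge0 // divr_ge0 //; first lra.
  by rewrite mulr_ge0 ?ltW // oneDsqr_gt0.
have mono x y : 0 <= x -> x <= y -> G x <= G y.
  move=> x0 xy; apply: (@nondecreasing_of_derive _ _ dG) => // z xyz.
  - by apply: DG; lra.
  - by apply: dG_ge0; lra.
have /nbhs_ballP[r /= r0 Hr] : \forall x \near 0, 0 < energy Q U x.
  have cE0 : {for 0, continuous (energy Q U)} by exact: continuous_energy.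
  have E0 : 0 < energy Q U 0 by rewrite energy0.
  exact: (cvgr_gt (energy Q U 0) cE0).
pose x := Num.min t (r / 2).
have x0 : 0 < x by rewrite /x lt_min t0; lra.
have xt : x <= t by rewrite /x ge_min lexx.
have xr : x <= r / 2 by rewrite /x ge_min lexx orbT.
have Ex : 0 < energy Q U x.
  by apply: Hr; rewrite /ball /= sub0r normrN gtr0_norm //; lra.
have : 0 < G t.
  apply: lt_le_trans (mono x t (ltW x0) xt).
  by rewrite mulr_gt0 // exprn_gt0 // integrating_factor_gt0.
by rewrite pmulr_lgt0 // exprn_gt0 // integrating_factor_gt0.
Qed.

(* Its sign is that of the angular velocity of [(Q, V)]. The integrating factor
   makes its derivative a positive multiple of [1 - a * t ^+ 2], so it is
   positive between [0] and any point where it is positive. *)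
Definition rotation t :=
  integrating_factor a t *
  (2 * w * t / (1 + a * t ^+ 2) * energy Q U t - Q t * (t * U t)).

Let q_gt0 t : 0 < 1 + a * t ^+ 2.
Proof. by have := mulr_ge0 (ltW a0) (sqr_ge0 t); lra. Qed.

Let Dg t : is_derive t 1 (fun x => 2 * w * x / (1 + a * x ^+ 2))
  (2 * w * (1 - a * t ^+ 2) / (1 + a * t ^+ 2) ^+ 2).
Proof.
notypeclasses refine (is_derive_eq _ _).
  by derivative; rewrite gt_eqF.
by rewrite /= !expr1; field; rewrite gt_eqF.
Qed.

Lemma continuous_rotation t : {for t, continuous rotation}.
Proof.
rewrite /rotation.
apply: continuousM; first exact: continuous_integrating_factor.
apply: continuousB.
  apply: continuousM; last exact: continuous_energy.
  exact: is_derive_continuous (Dg t).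
apply: continuousM; first exact: cQ.
by apply: continuousM; [exact: is_derive_continuous (is_derive_id _ _) | exact: cU].
Qed.

(** Multiplied by the integrating factor P, both Q V and w E / h have the term w P (Q^2 - V^2) in
    their theta derivatives. It cancels in the difference, leaving w P E times the derivative of
    1/h. *)
Lemma is_derive_rotation t : 0 < t -> is_derive t 1 rotation
  (2 * w * integrating_factor a t * energy Q U t *
    ((1 - a * t ^+ 2) / (1 + a * t ^+ 2) ^+ 2)).
Proof.
move=> t0; have [_ _ _ /(_ t t0) DQ /(_ t t0) DV] := osc.
have DE := is_derive_energy t0; have DP := is_derive_integrating_factor a t0.
notypeclasses refine (is_derive_eq (is_derive_mul DP
  (is_derive_add (is_derive_mul (Dg t) DE) (is_derive_opp (is_derive_mul DQ DV)))) _).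
have := gt_eqF (q_gt0 t); have := gt_eqF (oneDsqr_gt0 t).
rewrite /damping /energy.
move: (integrating_factor a t) (Q t) (U t) => k q y r0 s0.
by field; rewrite r0 s0 gt_eqF.
Qed.

Lemma rotation_gt0 T : 0 < T -> T * U T = 0 ->
  exists2 T', T < T' & forall t, 0 < t <= T' -> 0 < rotation t.
Proof.
move=> T0 VT.
have cR x : {for x, continuous rotation} by exact: continuous_rotation.
have rot0 : rotation 0 = 0 by rewrite /rotation /integrating_factor !mul0r.
pose dr t := 2 * w * integrating_factor a t * energy Q U t *
    ((1 - a * t ^+ 2) / (1 + a * t ^+ 2) ^+ 2).
have Dr t : 0 < t -> is_derive t 1 rotation (dr t) by exact: is_derive_rotation.
have coef_gt0 t : 0 < t -> 0 < 2 * w * integrating_factor a t * energy Q U t.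
  move=> t0; apply: mulr_gt0; last exact: energy_gt0 (ltW t0).
  by apply: mulr_gt0; [exact: mulr_gt0 | exact: integrating_factor_gt0].
have below t : 0 < t -> a * t ^+ 2 <= 1 -> 0 < rotation t.
  move=> t0 at1; rewrite -rot0.
  apply: (increasing_of_derive t0 (df := dr)) => x /andP[x0 xt].
  - exact: Dr.
  - exact: cR.
  rewrite mulr_gt0 ?coef_gt0 // divr_gt0 ?exprn_gt0 //.
  suff : a * x ^+ 2 < a * t ^+ 2 by lra.
  by rewrite ltr_pM2l // ltr_pXn2r // nnegrE ltW.
have rotT : 0 < rotation T.
  rewrite /rotation VT mulr0 subr0 mulr_gt0 ?integrating_factor_gt0 //.
  by rewrite mulr_gt0 ?divr_gt0 ?energy_gt0 ?mulr_gt0 // ltW.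
have above t : 0 < t <= T -> 1 <= a * t ^+ 2 -> 0 < rotation t.
  move=> /andP[t0 tT] at1; apply: (lt_le_trans rotT).
  rewrite -lerN2.
  apply: (@nondecreasing_of_derive _ (fun x => - rotation x) (fun x => - dr x)).
  - exact: tT.
  - by move=> x /andP[tx _]; apply: is_derive_opp; apply: Dr; lra.
  - by move=> x _; apply: continuousN; exact: cR.
  - move=> x /andP[tx _]; rewrite oppr_ge0.
    rewrite /dr pmulr_rle0 ?coef_gt0 //; last by lra.
    rewrite pmulr_lle0 ?invr_gt0 ?exprn_gt0 //.
    suff : a * t ^+ 2 < a * x ^+ 2 by lra.
    by rewrite ltr_pM2l // ltr_pXn2r // nnegrE ltW //; lra.
(* Continuity extends positivity slightly beyond [T]; the comparison needs [T] in the interior of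
   the interval on which the phase lives. *)
have /nbhs_ballP[r /= r0 Hr] : \forall x \near T, 0 < rotation x.
  exact: (cvgr_gt (rotation T) (cR T)).
exists (T + r / 2); first by lra.
move=> t /andP[t0 tr]; have [tT|Tt] := leP t T.
  have [at1|/ltW at1] := leP (a * t ^+ 2) 1; first exact: below.
  by apply: above => //; rewrite t0.
by apply: Hr; rewrite /ball /= distrC ger0_norm; lra.
Qed.

Lemma phase_rate_damping t : 0 < t ->
  phase_rate a w Q U t =
  2 / (1 + t ^+ 2) * (w - damping a t * (Q t * (t * U t) / energy Q U t)).
Proof.
move=> t0; rewrite /phase_rate /damping.
have := gt_eqF (energy_gt0 (ltW t0)).
move: (energy Q U t) (Q t) (U t) => e q y e0.
by field; rewrite e0 !gt_eqF // oneDsqr_gt0.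
Qed.

Lemma phase_rate_gt0 t : 0 < t -> 0 < rotation t -> 0 < phase_rate a w Q U t.
Proof.
move=> t0; rewrite /rotation pmulr_rgt0 ?integrating_factor_gt0 //.
rewrite phase_rate_damping // => rot0.
have E0 := energy_gt0 (ltW t0).
rewrite mulr_gt0 ?divr_gt0 ?oneDsqr_gt0 // subr_gt0 mulrA ltr_pdivrMr //.
rewrite /damping mulrAC ltr_pdivrMr ?mulr_gt0 //.
move: rot0; rewrite subr_gt0 mulrAC ltr_pdivlMr //.
move: (energy Q U t) (Q t) (U t) => e q y; lra.
Qed.

(** The two products determine [phi] modulo [pi], which is all that is used: they give the zeros of
    V, the angular velocity and the energy loss. *)
Definition phase_on T phi := phi 0 = 0 /\ forall t, 0 <= t <= T ->
  [/\ is_derive t 1 phi (phase_rate a w Q U t), 0 < phase_rate a w Q U t,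
      Q t * (t * U t) = energy Q U t * (sin (phi t) * cos (phi t)) &
      (t * U t) ^+ 2 = energy Q U t * sin (phi t) ^+ 2].

Lemma exists_phase T : 0 < T -> T * U T = 0 ->
  exists T' phi, T < T' /\ phase_on T' phi.
Proof.
move=> T0 VT; have [T' TT' rot] := rotation_gt0 T0 VT.
have [_ Q0 U0 DQ DV] := osc.
(* Even extension: [polar_angle] wants a velocity continuous on the whole line, but the energy in
   the denominator is known to be positive only for nonnegative arguments. *)
pose f t := phase_rate a w Q U `|t|.
have cf t : {for t, continuous f}.
  have cn : {for t, continuous (fun x : R => `|x|)} by exact: norm_continuous.
  have cQn : {for t, continuous (fun x => Q `|x|)}.
    by apply: (continuous_comp cn); exact: cQ.
  have cUn : {for t, continuous (fun x => U `|x|)}.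
    by apply: (continuous_comp cn); exact: cU.
  have cEn : {for t, continuous (fun x => energy Q U `|x|)}.
    by apply: (continuous_comp cn); exact: continuous_energy.
  have cn2 : {for t, continuous (fun x : R => `|x| ^+ 2)}.
    by apply: continuousM.
  rewrite /f /phase_rate; apply: continuousM.
    apply: continuousM; first exact: cst_continuous.
    apply: continuousV; first by rewrite gt_eqF ?oneDsqr_gt0.
    by apply: continuousD => //; exact: cst_continuous.
  apply: continuousB; first exact: cst_continuous.
  apply: continuousM.
    apply: continuousM; last exact: cst_continuous.
    apply: continuousD; first exact: cst_continuous.
    by apply: continuousM => //; exact: cst_continuous.
  apply: continuousM; first exact: continuousM.
  by apply: continuousV => //; rewrite gt_eqF ?energy_gt0.
have fE t : 0 <= t -> f t = phase_rate a w Q U t.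
  by move=> t0; rewrite /f ger0_norm.
have T'0 : 0 < T' by lra.
have DQ' t : 0 < t <= T' -> is_derive t 1 Q (- (2 * w * V t / (1 + t ^+ 2))).
  by case/andP=> t0 _; exact: DQ.
have DV' t : 0 < t <= T' ->
    is_derive t 1 V (2 * (w * Q t - damping a t * V t) / (1 + t ^+ 2)).
  by case/andP=> t0 _; exact: DV.
have cQ' t : 0 <= t <= T' -> {for t, continuous Q} by move=> _; exact: cQ.
have cV' t : 0 <= t <= T' -> {for t, continuous V}.
  move=> _; apply: continuousM; last exact: cU.
  exact: is_derive_continuous (is_derive_id _ _).
have Epos t : 0 <= t <= T' -> 0 < Q t ^+ 2 + V t ^+ 2.
  by case/andP=> t0 _; exact: energy_gt0.
have V0 : V 0 = 0 by rewrite /V mul0r.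
have rateE t : 0 < t <= T' -> f t * (Q t ^+ 2 + V t ^+ 2) =
    2 * (w * Q t - damping a t * V t) / (1 + t ^+ 2) * Q t -
    - (2 * w * V t / (1 + t ^+ 2)) * V t.
  case/andP=> t0 _; rewrite fE ?ltW // phase_rate_damping //.
  have := gt_eqF (energy_gt0 (ltW t0)).
  rewrite /damping /energy /V; move: (Q t) (U t) => q y e0.
  by field; rewrite e0 !gt_eqF // oneDsqr_gt0.
have [phi [phi0 Dphi sc ss]] := polar_angle T'0 DQ' DV' cQ' cV' Epos V0 cf rateE.
exists T', phi; split => //; split => // t tT.
split; [ | | exact: sc | exact: ss].
  by rewrite -fE; [exact: Dphi | case/andP: tT].
(* At [0] the damping term equals half of [w], so the rate is 2 (w - w/2) = w. *)
case/andP: tT; rewrite le_eqVlt => /predU1P[<- _|t0 tT].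
  rewrite /phase_rate energy0 Q0 U0 expr0n /= mulr0 !addr0 !divr1 mul1r.
  by rewrite mulr_gt0 //; have := w0; lra.
by rewrite phase_rate_gt0 // rot // t0.
Qed.

End one_oscillator.
End oscillator.

(** * Comparison of two oscillators *)

Section comparison.
Context {R : realType}.
Implicit Types (a t u v x : R).

(* [profile a t] is [d/dtheta (1 / damping)] as a function of [t]; the bound
   [a >= 1/3] is exactly what makes it decrease up to the minimum of the damping. *)
Definition profile a t :=
  (1 - a * t ^+ 2) * (1 + t ^+ 2) / (1 + a * t ^+ 2) ^+ 2.

Lemma oneDasqr_gt0 a t : 0 < a -> 0 < 1 + a * t ^+ 2.
Proof. by move=> a0; have := mulr_ge0 (ltW a0) (sqr_ge0 t); lra. Qed.

Lemma profile_ge0 a u : 0 < a -> a * u ^+ 2 <= 1 -> 0 <= profile a u.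
Proof.
move=> a0 au1; apply: divr_ge0; last exact: exprn_ge0 (ltW (oneDasqr_gt0 u a0)).
by apply: mulr_ge0; [rewrite subr_ge0 | exact: ltW (oneDsqr_gt0 u)].
Qed.

Lemma profile_decreasing a u t : 1 / 3 <= a -> 0 < u -> u < t ->
  a * t ^+ 2 <= 1 -> profile a t < profile a u.
Proof.
move=> a3 u0 ut at1; have a0 : 0 < a by lra.
rewrite /profile ltr_pdivrMr ?exprn_gt0 ?oneDasqr_gt0 //.
rewrite mulrAC ltr_pdivlMr ?exprn_gt0 ?oneDasqr_gt0 //.
have : u ^+ 2 < t ^+ 2 by rewrite ltr_pXn2r // nnegrE ltW //; lra.
have : 0 < u ^+ 2 by rewrite exprn_gt0.
move: (u ^+ 2) (t ^+ 2) at1 => x y ay1 x0 xy.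
rewrite -subr_gt0.
(* The cross-multiplied difference vanishes for [x = y]. In the cofactor [3 * a - 1] is the constant
   term, and all other terms are nonnegative because [a * y <= 1]. *)
have -> : (1 - a * x) * (1 + x) * (1 + a * y) ^+ 2 -
          (1 - a * y) * (1 + y) * (1 + a * x) ^+ 2 =
   (y - x) * (3 * a - 1 + a * (x + y) + 3 * a ^+ 2 * (x * y) +
     a ^+ 2 * y + a ^+ 2 * x * (1 - a * y)) by ring.
rewrite mulr_gt0 //; first lra.
have h1 : 0 < a * (x + y) by rewrite mulr_gt0 //; lra.
have h2 : 0 <= 3 * a ^+ 2 * (x * y).
  by rewrite !mulr_ge0 ?sqr_ge0 //; lra.
have h3 : 0 <= a ^+ 2 * y by rewrite mulr_ge0 ?sqr_ge0 //; lra.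
have h4 : 0 <= a ^+ 2 * x * (1 - a * y).
  by rewrite !mulr_ge0 ?sqr_ge0 //; lra.
lra.
Qed.

Lemma damping_gt0 a t : 0 < a -> 0 < t -> 0 < damping a t.
Proof. by move=> a0 t0; rewrite divr_gt0 ?oneDasqr_gt0 ?mulr_gt0. Qed.

Lemma damping_nonincreasing a u t : 0 < a -> 0 < u -> u <= t ->
  a * t ^+ 2 <= 1 -> damping a t <= damping a u.
Proof.
move=> a0 u0 ut at1; rewrite /damping.
rewrite ler_pdivrMr; last lra.
rewrite mulrAC ler_pdivlMr; last lra.
rewrite -subr_ge0.
have -> : (1 + a * u ^+ 2) * (2 * t) - (1 + a * t ^+ 2) * (2 * u) =
  2 * (t - u) * (1 - a * t * u) by ring.
have : a * t * u <= a * t ^+ 2.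
  by rewrite -mulrA expr2 ler_pM2l // ler_pM2l //; lra.
by move=> h; rewrite mulr_ge0 //; lra.
Qed.

Lemma damping_increasing a u t : 0 < a -> 0 < u -> u < t ->
  1 < a * u ^+ 2 -> damping a u < damping a t.
Proof.
move=> a0 u0 ut au1; rewrite /damping.
rewrite ltr_pdivrMr; last lra.
rewrite mulrAC ltr_pdivlMr; last lra.
rewrite -subr_gt0.
have -> : (1 + a * t ^+ 2) * (2 * u) - (1 + a * u ^+ 2) * (2 * t) =
  2 * (t - u) * (a * t * u - 1) by ring.
have : a * u ^+ 2 <= a * t * u.
  by rewrite -mulrA expr2 ler_pM2l // ler_pM2r //; lra.
by move=> h; rewrite mulr_gt0 //; lra.
Qed.

(** * Two oscillators matched at equal angles *)

Section two_oscillators.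
Variables (a w1 w2 : R) (Q1 U1 Q2 U2 phi1 phi2 : R -> R) (T1 T2 : R).
Hypotheses (a3 : 1 / 3 <= a) (w10 : 0 < w1) (w12 : w1 < w2).
Hypotheses (osc1 : oscillator a w1 Q1 U1) (osc2 : oscillator a w2 Q2 U2).
Hypotheses (T10 : 0 < T1) (T20 : 0 < T2).
Hypotheses (ph1 : phase_on a w1 Q1 U1 T1 phi1)
           (ph2 : phase_on a w2 Q2 U2 T2 phi2).
Variable s : R -> R.
Hypotheses
  (sP : forall t, 0 < t < T1 -> [/\ 0 < s t < T2, phi2 (s t) = phi1 t &
     is_derive t 1 s (phase_rate a w1 Q1 U1 t / phase_rate a w2 Q2 U2 (s t))])
  (s0 : forall e : R, 0 < e -> exists2 r, 0 < r &
     forall t, 0 < t < T1 -> t < r -> s t < e).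

Let a0 : 0 < a. Proof. by have := a3; lra. Qed.
Let w20 : 0 < w2. Proof. by have := w10; have := w12; lra. Qed.
(** Matched points have the same angle, so one function [sc] serves both oscillators; [k1 t] and
    [k2 t] are the theta velocities of [phi1] at [t] and of [phi2] at [s t]. *)
Let sc t := sin (phi1 t) * cos (phi1 t).
Let k1 t := w1 - damping a t * sc t.
Let k2 t := w2 - damping a (s t) * sc t.

Let s_gt0 t : 0 < t < T1 -> 0 < s t. Proof. by case/sP => /andP[]. Qed.

Let rate1 t : 0 < t < T1 -> phase_rate a w1 Q1 U1 t = 2 / (1 + t ^+ 2) * k1 t.
Proof.
move=> /andP[t0 tT]; rewrite (phase_rate_damping a0 osc1) //.
have [_ /(_ t)[|_ _ -> _]] := ph1; first by rewrite !ltW.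
by rewrite [energy _ _ _ * _]mulrC mulfK // gt_eqF // (energy_gt0 a0 osc1) // ltW.
Qed.

Let rate2 t : 0 < t < T1 ->
  phase_rate a w2 Q2 U2 (s t) = 2 / (1 + s t ^+ 2) * k2 t.
Proof.
move=> /sP[/andP[t0 tT] E _]; rewrite (phase_rate_damping a0 osc2) //.
have [_ /(_ (s t))[|_ _ -> _]] := ph2; first by rewrite !ltW.
rewrite E [energy _ _ _ * _]mulrC mulfK // gt_eqF //.
by rewrite (energy_gt0 a0 osc2) // ltW.
Qed.

Let k2_gt0 t : 0 < t < T1 -> 0 < k2 t.
Proof.
move=> tT; have [st _ _] := sP tT; have [_ /(_ (s t))[|_ + _ _]] := ph2.
  by case/andP: st => t0 t1; rewrite !ltW.
by rewrite rate2 // pmulr_rgt0 // divr_gt0 // oneDsqr_gt0.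
Qed.

Let Ds t : 0 < t < T1 -> is_derive t 1 s
  ((1 + s t ^+ 2) / (1 + t ^+ 2) * (k1 t / k2 t)).
Proof.
move=> tT; have [_ _ D] := sP tT; apply: is_derive_eq D _.
rewrite rate1 // rate2 //.
have := gt_eqF (k2_gt0 tT); move: (k1 t) (k2 t) => x y y0.
by field; rewrite y0 !gt_eqF // oneDsqr_gt0.
Qed.

Let start : exists2 d, 0 < d & forall t, 0 < t < T1 -> t < d ->
  [/\ 0 <= sc t, a * t ^+ 2 <= 1, a * s t ^+ 2 <= 1 & 0 < phi1 t < pi].
Proof.
(* For [0 < x < b] one has [x ^+ 2 <= x] and [a * x <= 1], hence [a * x ^+ 2 <= 1]. *)
pose b := Num.min 1 (a^-1).
have b0 : 0 < b by rewrite /b lt_min ltr01 invr_gt0 a0.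
have b1 : b <= 1 by rewrite /b ge_min lexx.
have ba : a * b <= 1.
  rewrite -(divff (lt0r_neq0 a0)) ler_pM2l //.
  by rewrite /b ge_min lexx orbT.
have small x : 0 < x -> x < b -> a * x ^+ 2 <= 1.
  move=> x0 xb; apply: le_trans ba; rewrite ler_pM2l //.
  have : x * x <= x * 1 by rewrite ler_pM2l //; lra.
  by rewrite expr2; lra.
have [r r0 Hr] := s0 b0.
have [phi10 D1] := ph1.
have c0 : {for 0, continuous phi1}.
  have [|D _ _ _] := D1 0; first by rewrite lexx ltW.
  exact: is_derive_continuous D.
have pi2 : phi1 0 < pi / 2 by rewrite phi10 divr_gt0 // pi_gt0.
have /nbhs_ballP[q /= q0 Hq] : \forall x \near 0, phi1 x < pi / 2.
  exact: (cvgr_lt (phi1 0) c0).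
exists (Num.min (Num.min r b) q); first by rewrite lt_min q0 andbT lt_min r0.
move=> t tT; rewrite lt_min => /andP[+ tq]; rewrite lt_min => /andP[tr tb].
have t0 : 0 < t by case/andP: tT.
have p2 : phi1 t < pi / 2.
  by apply: Hq; rewrite /ball /= sub0r normrN gtr0_norm.
have p0 : 0 < phi1 t.
  rewrite -phi10.
  apply: (increasing_of_derive t0 (df := phase_rate a w1 Q1 U1)) => x xt.
  - by have [|D _ _ _] := D1 x; [lra | exact: D].
  - have [|D _ _ _] := D1 x; [lra | exact: is_derive_continuous D].
  - by have [|_ D _ _] := D1 x; [lra | exact: D].
split; [ | exact: small | by apply: small; [exact: s_gt0 | exact: Hr] | ].
  rewrite mulr_ge0 //.
    by apply: sin_ge0_pi; have := pi_gt0 R; lra.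
  by apply: cos_ge0_pihalf; lra.
by have := pi_gt0 R; lra.
Qed.

(** Barrier argument for half the difference of the positions theta, whose derivative has the sign
    of [k1 - k2]. At a crossing both dampings agree, so [k2 - k1 = w2 - w1]. Near the start the
    damping decreases in [t] and [sc] is nonnegative, so [x <= s x] only makes [k2] larger. *)
Lemma faster_is_ahead t : 0 < t < T1 -> s t < t.
Proof.
move=> tT.
pose f x := atan (s x) - atan x.
pose df x := (1 + x ^+ 2)^-1 * (k1 x / k2 x - 1).
have Df x : 0 < x < T1 -> is_derive x 1 f (df x).
  move=> xT; have D1 := is_derive_fcomp (is_derive1_atan (s x)) (Ds xT).
  notypeclasses refine (is_derive_eq
    (is_derive_add D1 (is_derive_opp (is_derive1_atan x))) _).
  rewrite /df; have := gt_eqF (k2_gt0 xT).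
  move: (k1 x) (k2 x) => y z z0.
  by field; rewrite z0 !gt_eqF // oneDsqr_gt0.
have df_lt0 x : 0 < x < T1 -> k1 x < k2 x -> df x < 0.
  move=> xT k12; rewrite /df pmulr_rlt0 ?invr_gt0 ?oneDsqr_gt0 //.
  by rewrite subr_lt0 ltr_pdivrMr ?mul1r // k2_gt0.
have [d d0 Hd] := start.
suff : f t < 0.
  rewrite /f subr_lt0 => h; rewrite ltNge; apply/negP => /le_atan.
  by rewrite leNgt h.
apply: (negative_of_barrier d0 Df) => //.
- move=> e e0.
  have c0 : {for 0, continuous (@atan R)} by exact: continuous_atan.
  have a00 : atan (0 : R) < e by rewrite atan0.
  have /nbhs_ballP[q /= q0 Hq] : \forall x \near (0 : R), atan x < e.
    exact: (cvgr_lt (atan 0) c0).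
  have [r r0 Hr] := s0 q0; exists r => // x xT xr.
  have ax : 0 < atan x by rewrite -(@atan0 R) lt_atan //; case/andP: xT.
  have : atan (s x) < e.
    apply: Hq; rewrite /ball /= sub0r normrN gtr0_norm ?s_gt0 //.
    exact: Hr.
  by rewrite /f; lra.
- move=> x xT /eqP; rewrite /f subr_eq0 => /eqP E; apply: df_lt0 => //.
  have sx : s x = x by rewrite -[s x]atanK -[in RHS](atanK x) E.
  by rewrite /k1 /k2 sx; have := w12; lra.
- move=> x xT xd; rewrite /f subr_ge0 => E; apply: df_lt0 => //.
  have [sc0 ax asx _] := Hd x xT xd.
  have xs : x <= s x.
    by rewrite leNgt; apply/negP => /lt_atan; rewrite ltNge E.
  have x0 : 0 < x by case/andP: xT.
  have := ler_wpM2r sc0 (damping_nonincreasing a0 x0 xs asx).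
  by rewrite /k1 /k2; have := w12; lra.
Qed.

(** Barrier argument for the difference of the ratios w/h, which are regular at [0]. Where they
    agree, [k1 / k2 = w1 / w2], since each velocity is w (1 - (h/w) sin phi cos phi); the derivative
    then has the sign of [profile a x - profile a (s x)], where [s x < x]. *)
Lemma faster_is_less_damped t : 0 < t < T1 ->
  damping a (s t) * w1 < damping a t * w2.
Proof.
move=> tT.
pose g w x : R := 2 * w * x / (1 + a * x ^+ 2).
have gE w x : 0 < x -> g w x = w / damping a x.
  move=> x0; rewrite /g /damping; field.
  by rewrite !gt_eqF // oneDasqr_gt0.
have Dg w x : is_derive x 1 (g w)
    (2 * w * (1 - a * x ^+ 2) / (1 + a * x ^+ 2) ^+ 2).
  rewrite /g; notypeclasses refine (is_derive_eq _ _).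
    by derivative; rewrite gt_eqF // oneDasqr_gt0.
  by rewrite /= !expr1; field; rewrite gt_eqF // oneDasqr_gt0.
pose f x := g w1 x - g w2 (s x).
pose df x := 2 / (1 + x ^+ 2) *
  (w1 * profile a x - w2 * profile a (s x) * (k1 x / k2 x)).
have Df x : 0 < x < T1 -> is_derive x 1 f (df x).
  move=> xT; have D2 := is_derive_fcomp (Dg w2 (s x)) (Ds xT).
  notypeclasses refine (is_derive_eq
    (is_derive_add (Dg w1 x) (is_derive_opp D2)) _).
  rewrite /df /profile; have := gt_eqF (k2_gt0 xT).
  move: (k1 x) (k2 x) => y z z0.
  by field; rewrite z0 !gt_eqF // ?oneDsqr_gt0 // oneDasqr_gt0.
have g12 x : 0 < x < T1 ->
    (0 <= f x) = (damping a x * w2 <= damping a (s x) * w1).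
  move=> xT; have x0 : 0 < x by case/andP: xT.
  rewrite /f !gE ?s_gt0 // subr_ge0.
  rewrite ler_pdivrMr ?damping_gt0 ?s_gt0 // mulrAC.
  by rewrite ler_pdivlMr ?damping_gt0 // ![_ * damping _ _]mulrC.
have df_lt0 x : 0 < x < T1 -> profile a x < profile a (s x) ->
    w1 * profile a (s x) <= w2 * profile a (s x) * (k1 x / k2 x) -> df x < 0.
  move=> xT pr k12; rewrite /df pmulr_rlt0 ?divr_gt0 ?oneDsqr_gt0 //.
  have : w1 * profile a x < w1 * profile a (s x) by rewrite ltr_pM2l.
  by lra.
have [d d0 Hd] := start.
suff : f t < 0 by rewrite ltNge g12 // -ltNge.
apply: (negative_of_barrier d0 Df) => //.
- move=> e e0; exists (e / (2 * w1)); first by rewrite divr_gt0 ?mulr_gt0.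
  move=> x xT; rewrite ltr_pdivlMr ?mulr_gt0 // => xe.
  have x0 : 0 < x by case/andP: xT.
  have g2 : 0 < g w2 (s x) by rewrite gE ?s_gt0 // divr_gt0 // damping_gt0 // s_gt0.
  have : g w1 x <= 2 * w1 * x.
    rewrite /g ler_pdivrMr ?oneDasqr_gt0 // ler_peMr //.
      by rewrite !mulr_ge0 // ltW.
    by have := mulr_ge0 (ltW a0) (sqr_ge0 x); lra.
  by rewrite /f; lra.
- move=> x xT fx0; have x0 : 0 < x by case/andP: xT.
  have sx := faster_is_ahead xT; have s0x := s_gt0 xT.
  have dE : damping a x * w2 = damping a (s x) * w1.
    have dx := lt0r_neq0 (damping_gt0 a0 x0).
    have dsx := lt0r_neq0 (damping_gt0 a0 s0x).
    move: fx0 => /eqP; rewrite /f !gE // subr_eq0 eqr_div // => /eqP E.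
    by rewrite mulrC -E mulrC.
  apply: df_lt0 => //.
    have [ax1|ax1] := leP (a * x ^+ 2) 1; first exact: profile_decreasing.
    (* Past the minimum of the damping [profile] is negative. If [s x] is past it too, the faster
       oscillator has the smaller damping as well as the larger frequency, which contradicts the
       equality of ratios [dE]. *)
    have px : profile a x < 0.
      rewrite /profile pmulr_llt0 ?invr_gt0 ?exprn_gt0 ?oneDasqr_gt0 //.
      by rewrite pmulr_llt0 ?oneDsqr_gt0 //; lra.
    have [as1|as1] := leP (a * s x ^+ 2) 1.
      exact: lt_le_trans px (profile_ge0 a0 as1).
    have dsx := damping_increasing a0 s0x sx as1.
    have h1 : damping a (s x) * w1 < damping a x * w1 by rewrite ltr_pM2r.
    have h2 : damping a x * w1 < damping a x * w2.
      by rewrite ltr_pM2l // damping_gt0.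
    by move: h2; rewrite dE => h2; have := lt_trans h1 h2; rewrite ltxx.
  have -> : k1 x / k2 x = w1 / w2.
    have k20 := lt0r_neq0 (k2_gt0 xT); have w2n0 := lt0r_neq0 w20.
    apply/eqP; rewrite eqr_div // /k1 /k2 mulrBl mulrBr.
    by apply/eqP; congr (_ - _); rewrite mulrAC dE; ring.
  move: (profile a (s x)) => p.
  by have -> : w2 * p * (w1 / w2) = w1 * p by field; exact: lt0r_neq0.
- move=> x xT xd; rewrite g12 // => dle.
  have sx := faster_is_ahead xT; have s0x := s_gt0 xT.
  have [sc0 ax asx _] := Hd x xT xd.
  have pr := profile_decreasing a3 s0x sx ax.
  have ps := profile_ge0 a0 asx.
  apply: df_lt0 => //.
  (* After removal of the nonnegative factor [profile a (s x)] the claim is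
     [w1 * k2 x <= w2 * k1 x], which is [dle] multiplied by [sc x]. *)
  rewrite [w2 * _]mulrC -mulrA [w1 * _]mulrC ler_wpM2l // mulrA.
  rewrite ler_pdivlMr ?k2_gt0 // /k1 /k2.
  by have := ler_wpM2r sc0 dle; lra.
Qed.

(** As dE/dtheta = -2 h E sin^2 phi, the quotient [L] of the energies satisfies d(log L)/dphi = 2
    sin^2 phi (h1/k1 - h2/k2). In h1 k2 - h2 k1 the terms with sin phi cos phi cancel, and h1 w2 -
    h2 w1 is positive. *)
Lemma faster_has_more_energy t : 0 < t < T1 ->
  energy Q1 U1 t < energy Q2 U2 (s t).
Proof.
move=> tT; have t0 : 0 < t by case/andP: tT.
have E1 x : 0 < x < T1 -> 0 < energy Q1 U1 x.
  by move=> /andP[x0 _]; apply: (energy_gt0 a0 osc1); exact: ltW.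
have E2 x : 0 < x < T1 -> 0 < energy Q2 U2 (s x).
  by move=> xT; apply: (energy_gt0 a0 osc2); exact: ltW (s_gt0 xT).
pose L x := energy Q2 U2 (s x) / energy Q1 U1 x.
pose S x := sin (phi1 x) ^+ 2.
pose dL x := 4 / (1 + x ^+ 2) * L x * S x *
  ((damping a x * w2 - damping a (s x) * w1) / k2 x).
have DL x : 0 < x < T1 -> is_derive x 1 L (dL x).
  move=> xT; have x0 : 0 < x by case/andP: xT.
  have D1 := is_derive_energy osc1 x0.
  have D2 := is_derive_fcomp (is_derive_energy osc2 (s_gt0 xT)) (Ds xT).
  have e1 := E1 x xT.
  notypeclasses refine (is_derive_eq (is_derive_mul D2 (is_derive_inv _ D1)) _).
    by rewrite gt_eqF.
  have [_ /(_ x)[|_ _ _ ->]] := ph1; first by case/andP: xT => ? ?; rewrite !ltW.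
  have [sT E _] := sP xT.
  have [_ /(_ (s x))[|_ _ _ ->]] := ph2; first by case/andP: sT => ? ?; rewrite !ltW.
  rewrite E /dL /S /L.
  have := gt_eqF (k2_gt0 xT); have := gt_eqF e1.
  have -> : damping a x * w2 - damping a (s x) * w1 =
      damping a x * k2 x - damping a (s x) * k1 x by rewrite /k1 /k2; ring.
  move: (k1 x) (k2 x) (energy Q1 U1 x) (energy Q2 U2 (s x)) (sin (phi1 x)) =>
    p q e f i e0 q0.
  by field; rewrite e0 q0 !gt_eqF // oneDsqr_gt0.
have L0 x : 0 < x < T1 -> 0 < L x by move=> xT; rewrite divr_gt0 ?E1 ?E2.
have c_gt0 x : 0 < x < T1 ->
    0 < (damping a x * w2 - damping a (s x) * w1) / k2 x.
  by move=> xT; rewrite divr_gt0 ?k2_gt0 // subr_gt0 faster_is_less_damped.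
have dL_ge0 x : 0 < x < T1 -> 0 <= dL x.
  move=> xT; apply: mulr_ge0; last exact: ltW (c_gt0 x xT).
  apply: mulr_ge0; last exact: sqr_ge0.
  apply: ltW; apply: mulr_gt0; last exact: L0.
  by rewrite divr_gt0 // oneDsqr_gt0.
have cL x : 0 < x < T1 -> {for x, continuous L}.
  by move=> xT; exact: is_derive_continuous (DL x xT).
have mono x y : 0 < x -> x <= y -> y < T1 -> L x <= L y.
  move=> x0 xy yT; apply: (@nondecreasing_of_derive _ L dL) => // z zxy.
  - by apply: DL; lra.
  - by apply: cL; lra.
  - by apply: dL_ge0; lra.
have [d d0 Hd] := start.
have Llow e : 0 < e -> exists2 r, 0 < r &
    forall x, 0 < x < T1 -> x < r -> 1 - e < L x.
  move=> e0.
  have ce1 : {for 0, continuous (energy Q1 U1)} by exact: continuous_energy osc1 0.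
  have ce2 : {for 0, continuous (energy Q2 U2)} by exact: continuous_energy osc2 0.
  have lt1 : energy Q1 U1 0 < 1 + e / 2 by rewrite (energy0 osc1); lra.
  have lt2 : 1 - e / 2 < energy Q2 U2 0 by rewrite (energy0 osc2); lra.
  have /nbhs_ballP[q1 /= q10 H1] : \forall x \near 0, energy Q1 U1 x < 1 + e / 2.
    exact: (cvgr_lt (energy Q1 U1 0) ce1).
  have /nbhs_ballP[q2 /= q20 H2] : \forall x \near 0, 1 - e / 2 < energy Q2 U2 x.
    exact: (cvgr_gt (energy Q2 U2 0) ce2).
  have [r r0 Hr] := s0 q20.
  exists (Num.min r q1); first by rewrite lt_min r0 q10.
  move=> x xT; rewrite lt_min => /andP[xr xq].
  have x0 : 0 < x by case/andP: xT.
  have e1 : energy Q1 U1 x < 1 + e / 2.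
    by apply: H1; rewrite /ball /= sub0r normrN gtr0_norm.
  have e2 : 1 - e / 2 < energy Q2 U2 (s x).
    by apply: H2; rewrite /ball /= sub0r normrN gtr0_norm ?s_gt0 ?Hr.
  rewrite /L ltr_pdivlMr ?E1 //.
  have [e1'|e1'] := lerP 1 e.
    apply: le_lt_trans (E2 x xT).
    by apply: mulr_le0_ge0; [rewrite subr_le0 | exact: ltW (E1 x xT)].
  apply: lt_trans e2.
  have : (1 - e) * energy Q1 U1 x < (1 - e) * (1 + e / 2).
    by rewrite ltr_pM2l // subr_gt0.
  by move: (sqr_ge0 e); rewrite expr2; nra.
have L_ge1 x : 0 < x < T1 -> 1 <= L x.
  move=> xT; rewrite leNgt; apply/negP => Lx.
  have [|r r0 Hr] := Llow (1 - L x); first by rewrite subr_gt0.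
  have x0 : 0 < x by case/andP: xT.
  pose y := Num.min x (r / 2).
  have y0 : 0 < y by rewrite /y lt_min x0; lra.
  have yx : y <= x by rewrite /y ge_min lexx.
  have yr : y <= r / 2 by rewrite /y ge_min lexx orbT.
  have yT : 0 < y < T1 by case/andP: xT => _ xT1; lra.
  have := Hr y yT; have := mono y x y0 yx.
  by case/andP: xT => _ -> /(_ erefl); lra.
(* Strictness is gained at the start, where the angle lies strictly between [0] and [pi] and the
   derivative of [L] is positive; monotonicity carries it to [t]. *)
have : 1 < L t.
  pose y := Num.min t (d / 2).
  have y0 : 0 < y by rewrite /y lt_min t0; lra.
  have yt : y <= t by rewrite /y ge_min lexx.
  have yd : y <= d / 2 by rewrite /y ge_min lexx orbT.
  have tT1 : t < T1 by case/andP: tT.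
  apply: lt_le_trans (mono y t y0 yt tT1).
  apply: (@le_lt_trans _ _ (L (y / 2))); first by apply: L_ge1; lra.
  apply: (@increasing_of_derive _ L dL); first lra.
  - by move=> x xy; apply: DL; lra.
  - by move=> x xy; apply: cL; lra.
  - move=> x xy; have xT : 0 < x < T1 by lra.
    have [|_ _ _ phix] := Hd x xT; first by lra.
    apply: mulr_gt0; last exact: c_gt0.
    apply: mulr_gt0; last by rewrite exprn_gt0 // sin_gt0_pi.
    apply: mulr_gt0; last exact: L0.
    by rewrite divr_gt0 // oneDsqr_gt0.
by rewrite /L ltr_pdivlMr ?E1 // mul1r.
Qed.

End two_oscillators.

Theorem oscillator_comparison a (w1 w2 : R) (Q1 U1 Q2 U2 phi1 phi2 : R -> R)
    (T1 T2 : R) : 1 / 3 <= a -> 0 < w1 -> w1 < w2 ->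
  oscillator a w1 Q1 U1 -> oscillator a w2 Q2 U2 -> 0 < T1 -> 0 < T2 ->
  phase_on a w1 Q1 U1 T1 phi1 -> phase_on a w2 Q2 U2 T2 phi2 ->
  forall t u, 0 < t < T1 -> 0 < u < T2 -> phi1 t = phi2 u ->
  u < t /\ energy Q1 U1 t < energy Q2 U2 u.
Proof.
move=> a3 w10 w12 osc1 osc2.
(* If the first motion ends at the larger angle, [T1] is replaced by the point where [phi1] takes
   the value [phi2 T2]. This point still lies beyond [t]. *)
wlog le12 : T1 T2 / phi1 T1 <= phi2 T2.
  move=> wl T10 T20 ph1 ph2 t u tT uT E.
  have [le12|lt21] := leP (phi1 T1) (phi2 T2); first exact: (wl T1 T2).
  have [phi10 D1] := ph1; have [phi20 D2] := ph2.
  have c1 x : 0 <= x <= T1 -> {for x, continuous phi1}.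
    by move=> /D1[D _ _ _]; exact: is_derive_continuous D.
  have inc2 x y : 0 <= x -> x < y -> y <= T2 -> phi2 x < phi2 y.
    move=> x0 xy yT; apply: (increasing_of_derive xy (df := phase_rate a w2 Q2 U2)) =>
      z zxy.
    - by have [|D _ _ _] := D2 z; [lra | exact: D].
    - by have [|D _ _ _] := D2 z; [lra | exact: is_derive_continuous D].
    - by have [|_ D _ _] := D2 z; [lra | exact: D].
  have tlt : phi1 t < phi2 T2 by rewrite E; apply: inc2; lra.
  have [|||T tT' ET] := @intermediate_value _ phi1 t T1 (phi2 T2).
  - by lra.
  - by move=> x xT; apply: c1; lra.
  - by rewrite !ltW.
  have tT2 : t < T.
    rewrite lt_neqAle; apply/andP; split; last by case/andP: tT'.
    by apply/eqP => tE; move: tlt; rewrite tE ET ltxx.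
  apply: (wl T T2) => //; try lra.
  by split => // x xT; apply: D1; lra.
move=> T10 T20 ph1 ph2.
have [phi10 D1] := ph1; have [phi20 D2] := ph2.
have Dphi1 t : 0 <= t <= T1 -> is_derive t 1 phi1 (phase_rate a w1 Q1 U1 t).
  by case/D1.
have Dphi2 t : 0 <= t <= T2 -> is_derive t 1 phi2 (phase_rate a w2 Q2 U2 t).
  by case/D2.
have rate1_gt0 t : 0 <= t <= T1 -> 0 < phase_rate a w1 Q1 U1 t by case/D1.
have rate2_gt0 t : 0 <= t <= T2 -> 0 < phase_rate a w2 Q2 U2 t by case/D2.
have [s [sP sE s0]] := phase_matching T10 T20 Dphi1 Dphi2 rate1_gt0 rate2_gt0
  phi10 phi20 le12.
move=> t u tT uT E; rewrite -(sE t u tT uT E); split.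
  exact: (faster_is_ahead a3 w12 osc1 osc2 T10 ph1 ph2 sP s0).
exact: (faster_has_more_energy a3 w10 w12 osc1 osc2 T10 ph1 ph2 sP s0).
Qed.

End comparison.

(** * Jacobi polynomials *)

Section jacobi_polynomials.
Context {R : realType}.
Implicit Types (a b alpha beta x y : R) (n j : nat).

Lemma pochhammerS a n : pochhammer a n.+1 = pochhammer a n * (a + n%:R).
Proof. by rewrite /pochhammer big_ord_recr. Qed.

Lemma pochhammerSl a n : pochhammer a n.+1 = a * pochhammer (a + 1) n.
Proof.
rewrite /pochhammer big_ord_recl addr0; congr (_ * _).
by apply: eq_bigr => i _; rewrite -addrA -natr1 [1 + _]addrC.
Qed.

Lemma pochhammer_gt0 a n : 0 < a -> 0 < pochhammer a n.
Proof. by move=> a0; apply: prodr_gt0 => i _; rewrite ltr_wpDr. Qed.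

(* The coefficients of the Jacobi polynomial in powers of [(x - 1) / 2]. *)
Definition jacobi_coef n alpha beta j : R :=
  'C(n, j)%:R * pochhammer (n%:R + alpha + beta + 1) j *
    pochhammer (alpha + 1 + j%:R) (n - j) / n`!%:R.

Definition shifted_jacobi n alpha beta : {poly R} :=
  \poly_(j < n.+1) jacobi_coef n alpha beta j.

(** Valid for every [j], as the binomial coefficient vanishes beyond the degree; polynomial
    identities can thus be compared coefficientwise without ranges. *)
Lemma coef_shifted_jacobi n alpha beta j :
  (shifted_jacobi n alpha beta)`_j = jacobi_coef n alpha beta j.
Proof.
rewrite coef_poly ltnS; case: leqP => // nj.
by rewrite /jacobi_coef bin_small // !mul0r.
Qed.

Lemma jacobiE n alpha beta :
  jacobi n alpha beta = shifted_jacobi n alpha beta \Po (2^-1 *: ('X - 1)).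
Proof.
rewrite /jacobi /shifted_jacobi poly_def scaler_sumr raddf_sum.
apply: eq_bigr => j _; rewrite scalerA [RHS]comp_polyZ comp_Xn_poly; congr (_ *: _).
by rewrite /jacobi_coef mulrC.
Qed.

Lemma hornerE_jacobi n alpha beta x :
  (jacobi n alpha beta).[x] = (shifted_jacobi n alpha beta).[(x - 1) / 2].
Proof. by rewrite jacobiE horner_comp !hornerE mulrC. Qed.

Lemma hornerE_deriv_jacobi n alpha beta x : (jacobi n alpha beta)^`().[x] =
  (shifted_jacobi n alpha beta)^`().[(x - 1) / 2] / 2.
Proof.
rewrite jacobiE deriv_comp hornerM horner_comp !hornerE derivZ derivB derivX.
by rewrite derivC !hornerE /= subr0 mulr1 [2^-1 * _]mulrC.
Qed.

Lemma size_jacobi n alpha beta : (size (jacobi n alpha beta) <= n.+1)%N.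
Proof.
rewrite /jacobi (leq_trans (size_scale_leq _ _)) //.
apply: (leq_trans (size_sum _ _ _)); apply/bigmax_leqP => j _.
rewrite (leq_trans (size_scale_leq _ _)) // (leq_trans (size_poly_exp_leq _ _)) //.
have -> : size (2^-1 *: ('X - 1) : {poly R}) = 2.
  by rewrite size_scale ?invr_eq0 ?pnatr_eq0 // -polyC1 size_XsubC.
by rewrite mul1n ltn_ord.
Qed.

Lemma jacobi_neq0 n alpha beta : -1 < alpha -> jacobi n alpha beta != 0.
Proof.
move=> a1; apply/eqP => J0.
have : 0 < (jacobi n alpha beta).[1].
  by rewrite jacobi_at1 divr_gt0 ?ltr0n ?fact_gt0 // pochhammer_gt0 //; lra.
by rewrite J0 horner0 ltxx.
Qed.

(** The term ratio of the hypergeometric series. The difference [n%:R - j%:R] is taken in [R], and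
    for [j >= n] both sides are zero. *)
Lemma jacobi_coefS n alpha beta j :
  j.+1%:R * (alpha + 1 + j%:R) * jacobi_coef n alpha beta j.+1 =
  (n%:R - j%:R) * (n%:R + alpha + beta + 1 + j%:R) * jacobi_coef n alpha beta j.
Proof.
rewrite /jacobi_coef; have [nj|jn] := leqP n j.
  rewrite bin_small // !mul0r mulr0.
  move: nj; rewrite leq_eqVlt => /predU1P[->|nj]; first by rewrite subrr !mul0r.
  by rewrite [in RHS]bin_small // !mul0r mulr0.
have nf : n`!%:R != 0 :> R by rewrite pnatr_eq0 -lt0n fact_gt0.
have K : j.+1%:R * 'C(n, j.+1)%:R = (n%:R - j%:R) * 'C(n, j)%:R :> R.
  by rewrite -natrM mul_bin_left natrM natrB // ltnW.
have -> : (n - j)%N = (n - j.+1).+1 by rewrite subnSK.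
rewrite pochhammerS pochhammerSl -natr1 addrA.
move: (pochhammer _ j) (pochhammer _ (n - j.+1)) K => X Y; rewrite -natr1 => K.
transitivity (((j%:R + 1) * 'C(n, j.+1)%:R) * ((alpha + 1 + j%:R) * Y * X *
   (n%:R + alpha + beta + 1 + j%:R) / n`!%:R)); first by field.
by rewrite K; field.
Qed.

Lemma jacobi_coef_1_0 n beta j :
  j.+1%:R * jacobi_coef n 1 beta j = n.+1%:R * jacobi_coef n 0 (beta + 1) j.
Proof.
rewrite /jacobi_coef; have [jn|nj] := leqP j n; last first.
  by rewrite bin_small // !mul0r !mulr0.
have nf : n`!%:R != 0 :> R by rewrite pnatr_eq0 -lt0n fact_gt0.
have E := pochhammerS (0 + 1 + j%:R : R) (n - j).
rewrite pochhammerSl natrB // in E.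
have -> : n%:R + 0 + (beta + 1) + 1 = n%:R + 1 + beta + 1 :> R by ring.
have E1 : 1 + 1 + j%:R = 0 + 1 + j%:R + 1 :> R by ring.
rewrite E1 -!natr1.
set X := pochhammer _ j; set Y := pochhammer _ _ in E *.
set Z := pochhammer _ _ in E *.
transitivity ('C(n, j)%:R * X * ((0 + 1 + j%:R) * Y) / n`!%:R).
  by field.
by rewrite E; field.
Qed.

(** The derivative of (1+x)^(beta+1) times the polynomial, divided by (1+x)^beta; this is what
    identifies the critical points of [Q]. In powers of (x-1)/2 it combines [jacobi_coefS] and
    [jacobi_coef_1_0]. *)
Lemma jacobi_contiguous_1 n beta x :
  (beta + 1) * (jacobi n 0 (beta + 1)).[x] +
    (1 + x) * (jacobi n 0 (beta + 1))^`().[x] =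
  (n.+1%:R + beta) * (jacobi n 1 beta).[x].
Proof.
pose y := shifted_jacobi n 0 (beta + 1); pose p := shifted_jacobi n 1 beta.
have H : (beta + 1)%:P * y + y^`() + y^`() * 'X = (n.+1%:R + beta)%:P * p.
  apply/polyP => j; rewrite !coefD !coefCM coefMX coef_deriv.
  have -> : (if j == 0 then 0 else y^`()`_j.-1) = y`_j *+ j.
    by case: j => [|j] //=; rewrite coef_deriv.
  rewrite !coef_shifted_jacobi.
  have := jacobi_coefS n 0 (beta + 1) j; have := jacobi_coef_1_0 n beta j.
  have j0 : j.+1%:R != 0 :> R by rewrite pnatr_eq0.
  set pj := jacobi_coef n 1 beta j; set yj := jacobi_coef n 0 (beta + 1) j.
  set ys := jacobi_coef n 0 (beta + 1) j.+1.
  move=> E1 E2; apply: (mulfI j0).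
  transitivity (j.+1%:R * (beta + 1) * yj + j.+1%:R * (0 + 1 + j%:R) * ys +
      j.+1%:R * j%:R * yj); first by rewrite -natr1; ring.
  rewrite E2 [RHS]mulrCA E1 -!natr1; ring.
rewrite !hornerE_jacobi hornerE_deriv_jacobi -/y -/p; move: y p H => y p H.
have := congr1 (fun q : {poly R} => q.[(x - 1) / 2]) H.
rewrite /= !hornerE /= => <-; move: (_.[_]) (_.[_]) => u v; by field.
Qed.

(** The left side is the derivative of x - 1 times the polynomial, so in powers of (x-1)/2 this is
    [jacobi_coef_1_0] term by term. With the preceding relation it forms the first-order system
    behind the oscillator. *)
Lemma jacobi_contiguous_2 n beta x :
  (jacobi n 1 beta).[x] - (1 - x) * (jacobi n 1 beta)^`().[x] =
  n.+1%:R * (jacobi n 0 (beta + 1)).[x].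
Proof.
pose y := shifted_jacobi n 0 (beta + 1); pose p := shifted_jacobi n 1 beta.
have H : p + p^`() * 'X = n.+1%:R%:P * y.
  apply/polyP => j; rewrite coefD coefCM coefMX.
  have -> : (if j == 0 then 0 else p^`()`_j.-1) = p`_j *+ j.
    by case: j => [|j] //=; rewrite coef_deriv.
  by rewrite !coef_shifted_jacobi -jacobi_coef_1_0 -natr1; ring.
rewrite !hornerE_jacobi hornerE_deriv_jacobi -/y -/p; move: y p H => y p H.
have := congr1 (fun q : {poly R} => q.[(x - 1) / 2]) H.
rewrite /= !hornerE /= => <-; move: (_.[_]) (_.[_]) => u v; by field.
Qed.

Lemma jacobi_coef_rodrigues0 n alpha beta :
  (alpha + 1) * jacobi_coef n (alpha + 1) (beta + 1) 0 =
  n.+1%:R * jacobi_coef n.+1 alpha beta 0.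
Proof.
rewrite /jacobi_coef !bin0 !subn0 !addr0 pochhammerSl factS natrM.
rewrite /pochhammer !big_ord0.
have nf : n`!%:R != 0 :> R by rewrite pnatr_eq0 -lt0n fact_gt0.
have n1 : n.+1%:R != 0 :> R by rewrite pnatr_eq0.
move: (n.+1%:R : R) n1 => m m0.
by field; rewrite m0 nf.
Qed.

Lemma jacobi_coef_rodrigues n alpha beta j :
  (alpha + 1 + j.+1%:R) * jacobi_coef n (alpha + 1) (beta + 1) j.+1 +
    (alpha + beta + 2 + j%:R) * jacobi_coef n (alpha + 1) (beta + 1) j =
  n.+1%:R * jacobi_coef n.+1 alpha beta j.+1.
Proof.
rewrite /jacobi_coef; have [jn|nj] := leqP j n; last first.
  by rewrite !bin_small ?mul0r ?mulr0 ?addr0 // ?ltnS // ltnW.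
rewrite subSS factS natrM binS natrD.
have nf : n`!%:R != 0 :> R by rewrite pnatr_eq0 -lt0n fact_gt0.
have n1 : n.+1%:R != 0 :> R by rewrite pnatr_eq0.
have K : j.+1%:R * 'C(n, j.+1)%:R = (n%:R - j%:R) * 'C(n, j)%:R :> R.
  by rewrite -natrM mul_bin_left natrM natrB.
rewrite [pochhammer (n.+1%:R + _ + _ + _) _]pochhammerSl.
have -> : n.+1%:R + alpha + beta + 1 + 1 = n%:R + (alpha + 1) + (beta + 1) + 1 :> R.
  by rewrite -natr1; ring.
rewrite [pochhammer (n%:R + _ + _ + _) j.+1]pochhammerS.
have -> : alpha + 1 + 1 + j%:R = alpha + 1 + j.+1%:R by rewrite -natr1; ring.
have L : 'C(n, j.+1)%:R * ((alpha + 1 + j.+1%:R) *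
    pochhammer (alpha + 1 + 1 + j.+1%:R) (n - j.+1)) =
  'C(n, j.+1)%:R * pochhammer (alpha + 1 + j.+1%:R) (n - j) :> R.
  move: jn; rewrite leq_eqVlt => /predU1P[->|jn].
    by rewrite bin_small // !mul0r.
  have -> : (n - j)%N = (n - j.+1).+1 by rewrite subnSK.
  rewrite pochhammerSl; do 2 congr (_ * _).
  by congr pochhammer; ring.
set X := pochhammer (n%:R + _ + _ + _) j.
set Z := pochhammer (alpha + 1 + 1 + _) _ in L *.
set Y := pochhammer (alpha + 1 + j.+1%:R) _ in L *.
transitivity (('C(n, j.+1)%:R * ((alpha + 1 + j.+1%:R) * Z)) *
   (X * (n%:R + (alpha + 1) + (beta + 1) + 1 + j%:R)) / n`!%:R +
   (alpha + beta + 2 + j%:R) * ('C(n, j)%:R * X * Y / n`!%:R)); first by field.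
rewrite L.
transitivity (X * Y / n`!%:R * (j.+1%:R * 'C(n, j.+1)%:R +
   'C(n, j.+1)%:R * (n%:R + alpha + beta + 2) +
   (alpha + beta + 2 + j%:R) * 'C(n, j)%:R)).
  by rewrite -natr1; field.
rewrite K.
transitivity (('C(n, j.+1)%:R + 'C(n, j)%:R) *
  ((n.+1%:R + alpha + beta + 1) * X) * Y / n`!%:R); first by rewrite -natr1; field.
by rewrite -natr1 in n1 *; field; rewrite nf n1.
Qed.

(** One step of the Rodrigues formula: the derivative of (1-x)^(alpha+1) (1+x)^(beta+1) times the
    polynomial of degree [n], divided by (1-x)^alpha (1+x)^beta. *)
Lemma jacobi_rodrigues n alpha beta x :
  (1 - x) * (1 + x) * (jacobi n (alpha + 1) (beta + 1))^`().[x] +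
    ((beta + 1) * (1 - x) - (alpha + 1) * (1 + x)) *
      (jacobi n (alpha + 1) (beta + 1)).[x] =
  - (2 * n.+1%:R * (jacobi n.+1 alpha beta).[x]).
Proof.
pose p := shifted_jacobi n (alpha + 1) (beta + 1).
pose q := shifted_jacobi n.+1 alpha beta.
have H : (alpha + 1)%:P * p + p^`() * 'X +
    (p^`() * 'X + (alpha + beta + 2)%:P * p) * 'X = n.+1%:R%:P * q.
  have Xp j : (p^`() * 'X)`_j = p`_j *+ j.
    by rewrite coefMX; case: j => [|j] //=; rewrite coef_deriv.
  apply/polyP => -[|j]; rewrite !coefD !coefCM Xp coefMX /= !coef_shifted_jacobi.
    by rewrite mulr0n !addr0 jacobi_coef_rodrigues0.
  rewrite coefD Xp coefCM !coef_shifted_jacobi -jacobi_coef_rodrigues.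
  by ring.
rewrite !hornerE_jacobi hornerE_deriv_jacobi -/p -/q; move: p q H => p q H.
have := congr1 (fun q : {poly R} => q.[(x - 1) / 2]) H.
rewrite /= !hornerE /= => E; rewrite -[2 * _ * q.[_]]mulrA -E.
move: (_.[_]) (_.[_]) => u v; by field.
Qed.

End jacobi_polynomials.

(** * Zeros of Jacobi polynomials and critical points *)

Section roots.
Context {R : realType}.
Implicit Types (alpha beta c x y : R) (s : seq R) (n : nat).

Lemma continuous_norm_powR c x : 0 < c -> {for x, continuous (fun y => `|y| `^ c)}.
Proof.
move=> c0; have [->|x0] := eqVneq x 0.
  apply/cvgrPdist_lt => /= e e0; rewrite normr0 powR0 ?gt_eqF //.
  have r0 : 0 < e `^ c^-1 by rewrite powR_gt0.
  exists (e `^ c^-1) => //= y; rewrite /ball /= !sub0r !normrN => yr.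
  rewrite ger0_norm ?powR_ge0 //.
  have -> : e = (e `^ c^-1) `^ c.
    by rewrite -powRrM mulVf ?powRr1 ?ltW // gt_eqF.
  by rewrite gt0_ltr_powR // nnegrE ?normr_ge0 ?powR_ge0.
have n0 : 0 < `|x| by rewrite normr_gt0.
have cn : {for x, continuous (fun y : R => `|y|)} by exact: norm_continuous.
have cp : {for `|x|, continuous (fun y => y `^ c)}.
  exact: is_derive_continuous (is_derive1_powR c n0).
exact: (continuous_comp cn cp).
Qed.

Lemma is_derive_norm_powR c x : 0 < x ->
  is_derive x 1 (fun y => `|y| `^ c) (c * x `^ (c - 1)).
Proof.
move=> x0; apply: (@near_eq_is_derive _ _ _ (fun y => y `^ c)) => //.
- by near=> y; rewrite ger0_norm // ltW //; near: y; exact: lt_nbhsr.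
- exact: is_derive1_powR.
Unshelve. all: by end_near. Qed.

Lemma rolle_sequence (f df : R -> R) a b x s :
  (forall y, a < y < b -> is_derive y 1 f (df y)) ->
  (forall y, {for y, continuous f}) ->
  a <= x -> path <%R x s -> last x s <= b -> all (fun y => f y == 0) (x :: s) ->
  exists s', [/\ size s' = size s, path <%R x s',
    all (fun y => y < last x s) s' & all (fun y => df y == 0) s'].
Proof.
move=> fdf cf; elim: s x => [|y s IH] x; first by exists [::].
move=> ax /= /andP[xy ys] lb /and3P[fx fy fs].
have yl : y <= last y s.
  have := mem_last y s; rewrite inE => /predU1P[->//|ls].
  by move: ys; rewrite (path_sortedE lt_trans) => /andP[/allP /(_ _ ls) /ltW].
have fys : all (fun z => f z == 0) (y :: s) by rewrite /= fy.
have [s' [ss' ps' ls' ds']] := IH y (le_trans ax (ltW xy)) ys lb fys.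
have [|||c cxy D] := @Rolle _ f x y xy.
- move=> z; rewrite in_itv /= => /andP[xz zy].
  by have [|+ _] := fdf z; first lra.
- by apply: within_continuous => z _; exact: cf.
- by rewrite (eqP fx) (eqP fy).
exists (c :: s'); move: cxy; rewrite in_itv /= => /andP[xc cy].
split => /=.
- by rewrite ss'.
- rewrite xc /=; case: s' ps' {ss' ls' ds'} => //= z s' /andP[yz ->].
  by rewrite (lt_trans cy yz).
- by rewrite (lt_le_trans cy yl).
- rewrite ds' andbT; have D' : is_derive c 1 f (df c) by apply: fdf; lra.
  have [_ <-] := D'; have [_ ->] := D; exact: eqxx.
Qed.

(** Induction on the degree with both parameters raised by one. The weighted polynomial of degree
    [n] vanishes at its [n] roots and at both endpoints, and by [jacobi_rodrigues] the [n.+1] points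
    given by Rolle's theorem are roots one degree higher. *)
Lemma jacobi_roots n alpha beta : -1 < alpha -> -1 < beta ->
  exists s, [/\ size s = n, path <%R (-1) s, all (fun x => x < 1) s &
    all (root (jacobi n alpha beta)) s].
Proof.
elim: n alpha beta => [|n IH] alpha beta a1 b1; first by exists [::].
have [||s [ss ps s1 rs]] := IH (alpha + 1) (beta + 1); [lra | lra | ].
pose p := jacobi n (alpha + 1) (beta + 1).
(* Absolute values make the weight continuous on the whole line; inside the interval they change
   nothing. *)
pose f x := `|1 - x| `^ (alpha + 1) * `|1 + x| `^ (beta + 1) * p.[x].
pose df x := (1 - x) `^ alpha * (1 + x) `^ beta *
  (- (2 * n.+1%:R * (jacobi n.+1 alpha beta).[x])).
have a10 : 0 < alpha + 1 by lra.
have b10 : 0 < beta + 1 by lra.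
have Dp x : is_derive x 1 (fun y => p.[y]) p^`().[x] by exact: is_derive_poly.
have fdf x : -1 < x < 1 -> is_derive x 1 f (df x).
  move=> x1; have xm : 0 < 1 - x by lra.
  have xp : 0 < 1 + x by lra.
  have Dm : is_derive x 1 (fun y => 1 - y) (0 - 1) by derivative.
  have Dq : is_derive x 1 (fun y => 1 + y) (0 + 1) by derivative.
  have D1 := is_derive_fcomp (f := fun y => `|y| `^ (alpha + 1))
    (g := fun y => 1 - y) (is_derive_norm_powR (alpha + 1) xm) Dm.
  have D2 := is_derive_fcomp (f := fun y => `|y| `^ (beta + 1))
    (g := fun y => 1 + y) (is_derive_norm_powR (beta + 1) xp) Dq.
  notypeclasses refine (is_derive_eq (is_derive_mul (is_derive_mul D1 D2) (Dp x)) _).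
  rewrite /df -jacobi_rodrigues -/p !gtr0_norm // !addrK.
  rewrite !powRD ?powRr1 ?ltW //; try by rewrite ?(gt_eqF xm) ?(gt_eqF xp) implybT.
  by move: (_ `^ _) (_ `^ _) (p.[x]) (p^`().[x]) => u v q q'; ring.
have cf x : {for x, continuous f}.
  have cm : {for x, continuous (fun y : R => 1 - y)}.
    have Dm : is_derive x 1 (fun y => 1 - y) (0 - 1) by derivative.
    exact: is_derive_continuous Dm.
  have cq : {for x, continuous (fun y : R => 1 + y)}.
    have Dq : is_derive x 1 (fun y => 1 + y) (0 + 1) by derivative.
    exact: is_derive_continuous Dq.
  have c1 : {for x, continuous (fun y => `|1 - y| `^ (alpha + 1))}.
    exact: (continuous_comp cm (continuous_norm_powR (x := 1 - x) a10)).
  have c2 : {for x, continuous (fun y => `|1 + y| `^ (beta + 1))}.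
    exact: (continuous_comp cq (continuous_norm_powR (x := 1 + x) b10)).
  by apply: (continuousM (continuousM c1 c2)); exact: is_derive_continuous (Dp x).
have last1 : last (-1) s < 1.
  case/lastP: s s1 {ss ps rs} => [|s z] /=; first lra.
  by rewrite all_rcons last_rcons => /andP[].
have pr : path <%R (-1) (rcons s 1) by rewrite rcons_path ps.
have lr : last (-1) (rcons s 1) <= 1 by rewrite last_rcons.
have zr : all (fun x => f x == 0) (-1 :: rcons s 1).
  rewrite /= all_rcons; apply/and3P; split.
  - by rewrite /f subrr normr0 [0 `^ (beta + 1)]powR0 ?mulr0 ?mul0r // gt_eqF.
  - by rewrite /f subrr normr0 powR0 ?mul0r // gt_eqF.
  - by apply: sub_all rs => x /eqP px; rewrite /f px mulr0.
have [s' [ss' ps' ls' ds']] := rolle_sequence fdf cf (lexx _) pr lr zr.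
exists s'; split => //; first by rewrite ss' size_rcons ss.
  by move: ls'; rewrite last_rcons.
apply/allP => x xs.
have x1 : -1 < x < 1.
  move/allP: ls' => /(_ x xs); rewrite last_rcons => ->.
  by move: ps'; rewrite (path_sortedE lt_trans) => /andP[/allP /(_ x xs) -> _].
move/allP: ds' => /(_ x xs); rewrite /df mulf_eq0 oppr_eq0 mulf_eq0.
have /andP[xl xr] := x1.
have xm : 0 < 1 - x by lra.
have xp : 0 < 1 + x by lra.
rewrite mulf_eq0 !powR_eq0 (gt_eqF xm) (gt_eqF xp) /=.
by rewrite mulf_eq0 !pnatr_eq0.
Qed.

Lemma jacobi_rootE n alpha beta s : -1 < alpha -> size s = n -> uniq s ->
  all (root (jacobi n alpha beta)) s ->
  forall x, root (jacobi n alpha beta) x = (x \in s).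
Proof.
move=> a1 ss us rs x; apply/idP/idP; last by move/allP: rs; apply.
move=> rx; apply/negPn/negP => xs.
have rxs : all (root (jacobi n alpha beta)) (x :: s) by rewrite /= rx.
have uxs : uniq (x :: s) by rewrite /= xs.
have := max_poly_roots (jacobi_neq0 n beta a1) rxs uxs.
by rewrite /= ss => h; have := leq_trans h (size_jacobi n alpha beta); rewrite ltnn.
Qed.

Lemma is_derive_Q beta n x : -1 < x -> is_derive x 1 (Q beta n.+1)
  (2 `^ (- beta - 1) * (1 + x) `^ beta *
    ((n.+1%:R + beta) * (jacobi n 1 beta).[x])).
Proof.
move=> x1; have xp : 0 < 1 + x by lra.
have Dy : is_derive x 1 (fun y => (jacobi n 0 (beta + 1)).[y])
   (jacobi n 0 (beta + 1))^`().[x] by exact: is_derive_poly.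
have Dq : is_derive x 1 (fun y => 1 + y) (0 + 1) by derivative.
have D1 := is_derive_fcomp (f := fun y => y `^ (beta + 1))
    (g := fun y => 1 + y) (is_derive1_powR (beta + 1) xp) Dq.
have Dc := is_derive_cst (2 `^ (- beta - 1) : R) x 1.
rewrite /Q /=.
notypeclasses refine (is_derive_eq (is_derive_mul (is_derive_mul Dc D1) Dy) _).
rewrite -jacobi_contiguous_1 addrK /cst.
rewrite powRD ?powRr1 ?ltW //; last by rewrite (gt_eqF xp) implybT.
by move: (_ `^ _) (_ `^ _) (_.[_]) (_.[_]) => u v q q'; ring.
Qed.

Lemma critE beta n : -1 < beta ->
  crit beta n.+1 = [set x | -1 < x < 1 /\ root (jacobi n 1 beta) x].
Proof.
move=> b1; apply/seteqP; split => x [x1 H]; split => //; move: H;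
  have [xl _] := andP x1; have [_ D] := is_derive_Q beta n xl;
  rewrite derive1E D /root => /eqP.
- have xp : 0 < 1 + x by lra.
  rewrite mulf_eq0 mulf_eq0 !powR_eq0 (gt_eqF xp) pnatr_eq0 /= mulf_eq0.
  suff -> : (n.+1%:R + beta == 0) = false by [].
  by rewrite gt_eqF // -natr1; have := ler0n R n; lra.
- by move=> ->; rewrite !mulr0.
Qed.

(** [crit] is an explicit finite set, so [fset_set] does not fall back on its default, and sorting
    it downwards reverses the increasing list of roots. *)
Lemma xi_sequence beta n : -1 < beta -> exists s, [/\ size s = n,
  path <%R (-1) s, all (fun x => x < 1) s,
  (forall x, root (jacobi n 1 beta) x = (x \in s)) &
  forall k, xi beta k n.+1 = nth 0 (rev s) k.-1].
Proof.
move=> b1; have [|s [ss ps s1 rs]] := @jacobi_roots n 1 beta _ b1; first lra.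
have srt : sorted <%R s by exact: path_sorted ps.
have us : uniq s by exact: lt_sorted_uniq srt.
have a1 : -1 < 1 :> R by lra.
have rE := jacobi_rootE a1 ss us rs.
exists s; split => // k; rewrite /xi; congr (nth _ _ _).
have -> : crit beta n.+1 = [set` [fset x in s]%fset].
  rewrite critE //; apply/seteqP; split => x /=.
    by rewrite !inE rE => -[].
  rewrite !inE => xs; rewrite rE xs; split => //.
  rewrite (allP s1 x xs) andbT.
  by move: ps; rewrite (path_sortedE lt_trans) => /andP[/allP /(_ x xs) -> _].
rewrite set_fsetK.
apply: (sorted_eq ge_trans ge_anti).
- exact: (sort_sorted ge_total).
- by rewrite rev_sorted; apply: sub_sorted srt => x y /ltW.
- apply: uniq_perm; rewrite ?sort_uniq ?rev_uniq ?fset_uniq // => x.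
  by rewrite mem_sort mem_rev !inE.
Qed.

End roots.

(** * The oscillator of a Jacobi polynomial *)

Section jacobi_oscillator.
Context {R : realType}.
Implicit Types (beta t u x : R) (n k : nat).

(** This is cos theta in terms of t = tan (theta/2); [half_tan] inverts it. *)
Definition cayley t := (1 - t ^+ 2) / (1 + t ^+ 2).

Definition half_tan x := Num.sqrt ((1 - x) / (1 + x)).

Lemma half_tan_gt0 x : -1 < x < 1 -> 0 < half_tan x.
Proof. by move=> /andP[x0 x1]; rewrite sqrtr_gt0 divr_gt0 //; lra. Qed.

Lemma half_tanK x : -1 < x < 1 -> cayley (half_tan x) = x.
Proof.
move=> /andP[x0 x1]; have xp : 1 + x != 0 by rewrite gt_eqF //; lra.
rewrite /cayley /half_tan sqr_sqrtr; last by rewrite divr_ge0 //; lra.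
by field; rewrite xp /= gt_eqF //; lra.
Qed.

Lemma cayleyK t : 0 < t -> half_tan (cayley t) = t.
Proof.
move=> t0; have r0 := lt0r_neq0 (oneDsqr_gt0 t).
rewrite /half_tan /cayley.
have -> : (1 - (1 - t ^+ 2) / (1 + t ^+ 2)) / (1 + (1 - t ^+ 2) / (1 + t ^+ 2)) =
  t ^+ 2 by field; rewrite r0 /= gt_eqF //; lra.
by rewrite sqrtr_sqr gtr0_norm.
Qed.

Lemma half_tan_decreasing x u : -1 < x -> x < u -> u < 1 -> half_tan u < half_tan x.
Proof.
move=> x0 xu u1; rewrite ltNge; apply/negP => h.
have Hx := @half_tanK x; have Hu := @half_tanK u.
have hx : 0 < half_tan x by apply: half_tan_gt0; lra.
have : cayley (half_tan u) <= cayley (half_tan x).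
  rewrite /cayley ler_pdivrMr ?oneDsqr_gt0 // mulrAC ler_pdivlMr ?oneDsqr_gt0 //.
  have : half_tan x ^+ 2 <= half_tan u ^+ 2.
    by rewrite ler_pXn2r // nnegrE ltW //; apply: lt_le_trans h.
  by move: (_ ^+ 2) (_ ^+ 2) => p q; lra.
by rewrite Hu ?Hx ?leNgt ?xu //; lra.
Qed.

Definition frequency beta n := Num.sqrt (n.+1%:R * (n.+1%:R + beta)).

(** [n] is the degree, so this belongs to m = n + 1. It is [Q] at x = cos theta, because (1+x)/2 =
    1/(1+t^2). *)
Definition oscillator_Q beta n t :=
  (1 + t ^+ 2) `^ (- (beta + 1)) * (jacobi n 0 (beta + 1)).[cayley t].

(** V/t for V = -(dQ/dtheta)/w: by the derivative of [Q], V carries the factor sin theta =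
    2t/(1+t^2), from which [t] can be divided out. *)
Definition oscillator_U beta n t := (n.+1%:R + beta) / frequency beta n *
  ((1 + t ^+ 2) `^ (- (beta + 1)) * (jacobi n 1 beta).[cayley t]).

Lemma is_derive_cayley t : is_derive t 1 cayley (- (4 * t / (1 + t ^+ 2) ^+ 2)).
Proof.
have r0 := lt0r_neq0 (oneDsqr_gt0 t).
rewrite /cayley; notypeclasses refine (is_derive_eq _ _); first by derivative.
by rewrite /= !expr1; field.
Qed.

Lemma Q_cayley beta n t : Q beta n.+1 (cayley t) = oscillator_Q beta n t.
Proof.
have r0 := oneDsqr_gt0 t; rewrite /Q /oscillator_Q /=; congr (_ * _).
have -> : 1 + cayley t = 2 / (1 + t ^+ 2).
  by rewrite /cayley; field; rewrite gt_eqF.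
rewrite -opprD !powRN.
have p2 : (2 : R) `^ (beta + 1) != 0 by rewrite gt_eqF // powR_gt0.
have pr : (1 + t ^+ 2) `^ (beta + 1) != 0 by rewrite gt_eqF // powR_gt0.
have E : (2 / (1 + t ^+ 2)) `^ (beta + 1) * (1 + t ^+ 2) `^ (beta + 1) = 2 `^ (beta + 1).
  by rewrite -powRM ?divfK ?divr_ge0 // ?ltW // gt_eqF.
by apply: (mulIf pr); rewrite -mulrA E !mulVf.
Qed.

Lemma jacobi0_at1 beta n : (jacobi n 0 beta).[1] = 1.
Proof.
rewrite jacobi_at1 add0r.
have -> : pochhammer 1 n = n`!%:R :> R.
  elim: n => [|n IH]; first by rewrite /pochhammer big_ord0.
  by rewrite pochhammerS IH factS natrM mulrC -natr1 addrC.
by rewrite divff // pnatr_eq0 -lt0n fact_gt0.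
Qed.

Section fixed_degree.
Variables (beta : R) (n : nat).
Hypothesis b1 : -1 < beta.
Let w := frequency beta n.
Let B := n.+1%:R + beta.

Let B0 : 0 < B.
Proof. by rewrite /B -natr1; have := ler0n R n; have := b1; lra. Qed.

Lemma frequency_gt0 : 0 < frequency beta n.
Proof. by rewrite sqrtr_gt0 mulr_gt0. Qed.

Let w2 : w ^+ 2 = n.+1%:R * B.
Proof. by rewrite sqr_sqrtr // mulr_ge0 // ltW. Qed.

Lemma jacobi_oscillator :
  oscillator (2 * beta + 1) w (oscillator_Q beta n) (oscillator_U beta n).
Proof.
have wn0 := lt0r_neq0 frequency_gt0; rewrite -/w in wn0.
pose y := jacobi n 0 (beta + 1); pose p := jacobi n 1 beta.
have De t := is_derive_powR_oneDsqr (- (beta + 1)) t.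
have Dpoly (q : {poly R}) t : is_derive t 1 (fun x => q.[cayley x])
    (q^`().[cayley t] * - (4 * t / (1 + t ^+ 2) ^+ 2)).
  have Dq : is_derive (cayley t) 1 (fun x => q.[x]) q^`().[cayley t].
    exact: is_derive_poly.
  exact: (is_derive_fcomp (f := fun x => q.[x]) Dq (is_derive_cayley t)).
have DQ t := is_derive_mul (De t) (Dpoly y t).
have DU t := is_derive_mul (is_derive_cst (B / w) t 1)
  (is_derive_mul (De t) (Dpoly p t)).
have cayley0 : cayley 0 = 1 by rewrite /cayley expr0n subr0 addr0 divr1.
have I1 t : B * p.[cayley t] =
    (beta + 1) * y.[cayley t] + 2 / (1 + t ^+ 2) * y^`().[cayley t].
  rewrite /B /p -jacobi_contiguous_1 -/y; congr (_ + _ * _).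
  by rewrite /cayley; field; rewrite gt_eqF // oneDsqr_gt0.
have I2 t : w * y.[cayley t] = B / w * (p.[cayley t] -
    2 * t ^+ 2 / (1 + t ^+ 2) * p^`().[cayley t]).
  have -> : 2 * t ^+ 2 / (1 + t ^+ 2) = 1 - cayley t.
    by rewrite /cayley; field; rewrite gt_eqF // oneDsqr_gt0.
  rewrite /p jacobi_contiguous_2 -/y mulrA; congr (_ * _).
  by apply: (mulIf wn0); rewrite -expr2 w2; field.
split.
- split=> t; [exact: is_derive_continuous (DQ t) | exact: is_derive_continuous (DU t)].
- by rewrite /oscillator_Q cayley0 expr0n addr0 powR1 jacobi0_at1 mulr1.
(* The value at [1] of the polynomial with parameters (1, beta) is not computed separately; [I2] at
   [t = 0] contains it. *)
- rewrite /oscillator_U cayley0 expr0n addr0 powR1 mul1r -/w -/B.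
  have := I2 0; rewrite cayley0 /y jacobi0_at1 mulr1 => E.
  by rewrite [RHS]E expr0n /= mulr0 !mul0r subr0.
- move=> t t0; apply: is_derive_eq (DQ t) _.
  rewrite /oscillator_U -/w -/B -/p; move: (I1 t).
  move: (_ `^ _) (y.[_]) (y^`().[_]) (p.[_]) => e q q' r E.
  have -> : 2 * w * (t * (B / w * (e * r))) = 2 * t * e * (B * r) by field.
  by rewrite E; field; rewrite gt_eqF // oneDsqr_gt0.
- move=> t t0; apply: is_derive_eq (is_derive_mul (is_derive_id t 1) (DU t)) _.
  rewrite /oscillator_U /oscillator_Q /damping -/w -/B -/p -/y /cst; move: (I2 t).
  move: (_ `^ _) (y.[_]) (p^`().[_]) (p.[_]) => e q p' r E.
  have -> : w * (e * q) = e * (w * q) by ring.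
  by rewrite E; field; rewrite wn0 !gt_eqF // oneDsqr_gt0.
Qed.

Lemma oscillator_U_eq0 t : 0 < t ->
  (t * oscillator_U beta n t == 0) = root (jacobi n 1 beta) (cayley t).
Proof.
move=> t0; rewrite /oscillator_U !mulf_eq0 powR_eq0 invr_eq0.
rewrite (gt_eqF t0) (gt_eqF B0) (gt_eqF frequency_gt0).
by rewrite (gt_eqF (oneDsqr_gt0 t)).
Qed.

End fixed_degree.

Lemma sin_pi_multiple x k : sin (x + pi *+ k) = (-1) ^+ k * sin x.
Proof.
elim: k => [|k IH]; first by rewrite mulr0n addr0 mul1r.
by rewrite mulrSr addrA sinDpi IH exprS mulN1r mulNr.
Qed.

(** At positive arguments in the range, [sin] of the phase vanishes exactly at the listed points.
    Between consecutive ones the phase increases and, by intermediate values, cannot pass the next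
    multiple of [pi]; so it gains exactly [pi] each time. The first gap starts at [0], where the
    phase is [0] although [0] is not in the list. *)
Lemma phase_at_zeros a w (Q U phi : R -> R) T (z : seq R) :
  0 < a -> oscillator a w Q U -> phase_on a w Q U T phi -> path <%R 0 z ->
  (forall t, 0 < t -> (t * U t == 0) = (t \in z)) ->
  forall k, (k < size z)%N -> nth 0 z k <= T -> phi (nth 0 z k) = pi *+ k.+1.
Proof.
move=> a0 osc [phi0 ph] pz Uz.
have z_gt0 t : t \in z -> 0 < t.
  by move: pz; rewrite (path_sortedE lt_trans) => /andP[/allP h _] /h.
have sin_eq0 t : 0 < t <= T -> (sin (phi t) == 0) = (t \in z).
  move=> /andP[t0 tT]; have [|_ _ _ E] := ph t; first by rewrite tT ltW.
  rewrite -Uz // -[LHS]sqrf_eq0 -[RHS]sqrf_eq0 E [RHS]mulf_eq0.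
  by rewrite (gt_eqF (energy_gt0 a0 osc (ltW t0))).
have next u v k : 0 <= u -> u < v -> v <= T -> phi u = pi *+ k -> v \in z ->
    (forall c, u < c < v -> c \notin z) -> phi v = pi *+ k.+1.
  move=> u0 uv vT pu vz gap.
  have cphi x : u <= x <= v -> {for x, continuous phi}.
    by move=> xuv; have [|D _ _ _] := ph x; [lra | exact: is_derive_continuous D].
  have uphi : phi u < phi v.
    apply: (increasing_of_derive uv (df := phase_rate a w Q U)) => x xuv.
    - by have [|D _ _ _] := ph x; [lra | exact: D].
    - exact: cphi.
    - by have [|_ D _ _] := ph x; [lra | exact: D].
  have vphi : phi v <= pi *+ k.+1.
    rewrite leNgt; apply/negP => lt.
    have [|c cuv cE] := @intermediate_value _ phi u v (pi *+ k.+1) (ltW uv) cphi.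
      by rewrite (ltW lt) andbT pu mulrSr lerDl pi_ge0.
    have uc : u < c.
      rewrite lt_neqAle; case/andP: cuv => -> _; rewrite andbT.
      apply/eqP => ucE; move: cE; rewrite -ucE pu mulrSr => /eqP.
      by rewrite eq_sym -subr_eq0 addrAC subrr add0r (gt_eqF (pi_gt0 R)).
    have cv : c < v.
      rewrite lt_neqAle; case/andP: cuv => _ ->; rewrite andbT.
      by apply/eqP => cvE; move: lt; rewrite -cvE cE ltxx.
    have : c \in z.
      rewrite -sin_eq0; last lra.
      by rewrite cE -[pi *+ k.+1]add0r sin_pi_multiple sin0 mulr0.
    by apply/negP; apply: gap; rewrite uc.
  have s0 : sin (phi v - pi *+ k) = 0.
    have : sin (phi v) == 0 by rewrite sin_eq0 //; lra.
    rewrite -[phi v](subrK (pi *+ k)) sin_pi_multiple mulf_eq0 signr_eq0 /=.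
    by rewrite subrK => /eqP.
  apply/eqP; rewrite eq_le vphi /= leNgt; apply/negP => lt.
  have : 0 < sin (phi v - pi *+ k).
    by apply: sin_gt0_pi; move: lt; rewrite mulrSr -pu; lra.
  by rewrite s0 ltxx.
elim=> [|k IH] kz kT.
  apply: (next 0) => //; first exact/z_gt0/mem_nth; first exact: mem_nth.
  move=> c /andP[c0 cz]; apply/negP => cin.
  have srt : sorted <%R z := path_sorted pz.
  have : nth 0 z (index c z) < nth 0 z 0 by rewrite nth_index.
  by rewrite lt_sorted_ltn_nth ?inE ?index_mem.
have srt : sorted <%R z := path_sorted pz.
have kz' : (k < size z)%N by exact: ltnW.
have kk : nth 0 z k < nth 0 z k.+1 by rewrite lt_sorted_ltn_nth.
apply: (next (nth 0 z k)) => //.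
- exact/ltW/z_gt0/mem_nth.
- by apply: IH => //; lra.
- exact: mem_nth.
move=> c /andP[c0 cz]; apply/negP => cin; move: c0 cz.
have ci : (index c z < size z)%N by rewrite index_mem.
rewrite -{1 2}(nth_index 0 cin) !lt_sorted_ltn_nth //.
by move=> h1 h2; have := leq_trans h2 h1; rewrite ltnn.
Qed.

(** [half_tan] reverses the order, so the largest critical point becomes the smallest [t]. [xi]
    counts from [1] and the list from [0], hence [k.-1]. *)
Lemma critical_sequence beta n : -1 < beta -> exists z : seq R,
  [/\ size z = n, path <%R 0 z,
   forall t, 0 < t -> (t * oscillator_U beta n t == 0) = (t \in z) &
   forall k, (k.-1 < n)%N -> xi beta k n.+1 = cayley (nth 0 z k.-1)].
Proof.
move=> b1; have [s [ss ps s1 rE xiE]] := xi_sequence n b1.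
have sI x : x \in s -> -1 < x < 1.
  move=> xs; rewrite (allP s1 x xs) andbT.
  by move: ps; rewrite (path_sortedE lt_trans) => /andP[/allP /(_ x xs) -> _].
exists (rev (map half_tan s)); split.
- by rewrite size_rev size_map.
- rewrite (path_sortedE lt_trans) rev_sorted; apply/andP; split.
    apply/allP => t; rewrite mem_rev => /mapP[x xs ->].
    exact: half_tan_gt0 (sI x xs).
  have dec : {in s &, {homo half_tan : x y / x < y >-> y < x}}.
    move=> x y xs ys xy; apply: half_tan_decreasing => //.
      by case/andP: (sI x xs).
    by case/andP: (sI y ys).
  exact: (homo_sorted_in dec (allss s) (path_sorted ps)).
- move=> t t0; rewrite oscillator_U_eq0 // rE mem_rev.
  apply/idP/mapP => [ts|[x xs ->]]; first by exists (cayley t); rewrite ?cayleyK.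
  by rewrite half_tanK // sI.
- move=> k kn; rewrite xiE -map_rev (nth_map 0) ?size_rev ?ss // half_tanK //.
  by apply: sI; rewrite -mem_rev mem_nth // size_rev ss.
Qed.

End jacobi_oscillator.

(** * Comparison of consecutive degrees at the same critical index *)

Theorem corollary4p5 (R : realType) (beta : R) (hbeta : - (1 / 3) <= beta)
    (m : nat) (hm : (2 <= m)%N) (k : nat) (hk : (1 <= k <= m - 1)%N) :
  xi beta k m.+1 > xi beta k m /\
  `|Q beta m.+1 (xi beta k m.+1)| > `|Q beta m (xi beta k m)|.
Proof.
have b1 : -1 < beta by lra.
have a0 : 0 < 2 * beta + 1 by lra.
have a3 : 1 / 3 <= 2 * beta + 1 by lra.
case: m hm hk => [//|n] _ hk.
have kn : (k.-1 < n)%N by lia.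
have kn1 : (k.-1 < n.+1)%N by lia.
have [z1 [sz1 pz1 Uz1 xi1]] := critical_sequence n b1.
have [z2 [sz2 pz2 Uz2 xi2]] := critical_sequence n.+1 b1.
rewrite xi1 // xi2 // !Q_cayley.
set t := nth 0 z1 _; set u := nth 0 z2 _.
have tz : t \in z1 by rewrite mem_nth ?sz1.
have uz : u \in z2 by rewrite mem_nth ?sz2.
have t0 : 0 < t.
  by move: pz1; rewrite (path_sortedE lt_trans) => /andP[/allP /(_ t tz)].
have u0 : 0 < u.
  by move: pz2; rewrite (path_sortedE lt_trans) => /andP[/allP /(_ u uz)].
have Vt : t * oscillator_U beta n t = 0 by apply/eqP; rewrite Uz1.
have Vu : u * oscillator_U beta n.+1 u = 0 by apply/eqP; rewrite Uz2.
have osc1 := jacobi_oscillator n b1; have osc2 := jacobi_oscillator n.+1 b1.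
have w10 := frequency_gt0 n b1; have w20 := frequency_gt0 n.+1 b1.
have w12 : frequency beta n < frequency beta n.+1.
  have := ler0n R n => n0.
  rewrite ltr_sqrt; last by rewrite mulr_gt0 // -!natr1; lra.
  by rewrite -!natr1; nra.
have [T1 [phi1 [tT1 ph1]]] := exists_phase a0 w10 osc1 t0 Vt.
have [T2 [phi2 [uT2 ph2]]] := exists_phase a0 w20 osc2 u0 Vu.
(* Since [k >= 1], the multiple is [k]: both critical points lie at the angle [k] times [pi], and
   the oscillators can be compared there. *)
have E1 : phi1 t = pi *+ k.-1.+1.
  by apply: (phase_at_zeros a0 osc1 ph1 pz1 Uz1); rewrite ?sz1 // ltW.
have E2 : phi2 u = pi *+ k.-1.+1.
  by apply: (phase_at_zeros a0 osc2 ph2 pz2 Uz2); rewrite ?sz2 // ltW.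
have tT : 0 < t < T1 by rewrite t0.
have uT : 0 < u < T2 by rewrite u0.
have [ut E12] := oscillator_comparison a3 w10 w12 osc1 osc2 (lt_trans t0 tT1)
  (lt_trans u0 uT2) ph1 ph2 tT uT (etrans E1 (esym E2)).
split.
  have u2 : u ^+ 2 < t ^+ 2 by rewrite ltr_pXn2r // nnegrE ltW.
  rewrite /cayley ltr_pdivrMr ?oneDsqr_gt0 // mulrAC ltr_pdivlMr ?oneDsqr_gt0 //.
  by lra.
rewrite -ltr_sqr // !real_normK ?num_real //.
by move: E12; rewrite /energy Vt Vu expr0n !addr0.
Qed.
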